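(* Let $2\le k\le t$ be fixed integers. There exists $m_0$ such that for all $m\ge m_0$: if $G$ is a $K_{k+1,t+1}^+$-free graph with $m$ edges, then $\lambda(G)\le\lambda(S_{k,m})$, with equality if and only if $G=S_{k,m}$.
   Context: All graphs are finite and simple; isolated vertices are ignored. $K_{k+1,t+1}^+$ is the graph obtained from the complete bipartite graph $K_{k+1,t+1}$ by adding one edge inside the part of size $k+1$. Split graph: for $1\le k<m$, write $m-\binom{k}{2}=kt'+r$ with integers $t'\ge 1$ and $0\le r\le k-1$; $S_{k,m}$ is the $m$-edge graph obtained from $K_k\vee t'K_1$ (a clique $K_k$ joined to $t'$ independent vertices) by adding one extra vertex adjacent to exactly $r$ vertices of the $K_k$. $\lambda(G)$ is the spectral radius of the adjacency matrix; $F$-free means no subgraph isomorphic to $F$. *)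

(* Defs.v *)
From HB Require Import structures.
From mathcomp Require Import all_boot all_order all_algebra.
From mathcomp Require Import boolp classical_sets reals.
Set Implicit Arguments. Unset Strict Implicit. Unset Printing Implicit Defensive.
Import Order.TTheory GRing.Theory Num.Theory.

Definition simple_graph (V : finType) (e : rel V) : Prop :=
  symmetric e /\ irreflexive e.

Definition edges (V : finType) (e : rel V) : {set {set V}} :=
  [set E : {set V} | [exists x, [exists y, e x y && (E == [set x; y])]]].

Definition nonisol (V : finType) (e : rel V) : {set V} :=
  [set x | [exists y, e x y]].

Definition has_subgraph (W V : finType) (f : rel W) (e : rel V) : Prop :=
  exists phi : W -> V, injective phi /\ forall a b, f a b -> e (phi a) (phi b).

Definition F_free (W V : finType) (f : rel W) (e : rel V) : Prop :=
  ~ has_subgraph f e.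

(* Equality of graphs, isolated vertices being ignored: an isomorphism between
   the subgraphs induced on the non-isolated vertices. *)
Definition same_graph (V W : finType) (e : rel V) (e' : rel W) : Prop :=
  exists phi : V -> W,
    {in nonisol e &, injective phi} /\
    phi @: nonisol e = nonisol e' /\
    {in nonisol e &, forall x y, e' (phi x) (phi y) = e x y}.

Definition adjmx (R : realType) (V : finType) (e : rel V) : 'M[R]_#|V| :=
  \matrix_(i, j) ((e (enum_val i) (enum_val j))%:R)%R.

(* Spectral radius: the largest modulus of an eigenvalue of the adjacency
   matrix (adjacency matrices of simple graphs are real symmetric, so all
   eigenvalues are real). *)
Definition spec_rad (R : realType) (V : finType) (e : rel V) : R :=
  sup [set `|a|%R | a in [set a : R | eigenvalue (adjmx R e) a]%classic]%classic.

Definition Kplus_rel (k t : nat) (x y : 'I_k.+1 + 'I_t.+1) : bool :=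
  match x, y with
  | inl a, inr _ => true
  | inr _, inl b => true
  | inl a, inl b => ((val a == 0) && (val b == 1)) || ((val a == 1) && (val b == 0))
  | inr _, inr _ => false
  end.

(* S_{k,m}: write m - C(k,2) = k t' + r with 0 <= r <= k-1;
   K_k (inl (inl _)) joined to t' independent vertices (inl (inr _)),
   plus an extra vertex (inr tt) adjacent to the first r clique vertices. *)
Definition S_t' (k m : nat) : nat := (m - 'C(k, 2)) %/ k.
Definition S_r (k m : nat) : nat := (m - 'C(k, 2)) %% k.

Definition S_vert (k m : nat) : finType := (('I_k + 'I_(S_t' k m)) + unit)%type.

Definition S_rel (k m : nat) (x y : S_vert k m) : bool :=
  match x, y with
  | inl (inl a), inl (inl b) => a != b
  | inl (inl _), inl (inr _) => true
  | inl (inr _), inl (inl _) => true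
  | inl (inr _), inl (inr _) => false
  | inl (inl a), inr _ => val a < S_r k m
  | inr _, inl (inl b) => val b < S_r k m
  | _, _ => false
  end.

(* Main.v *)
(* Let x be the unit Perron vector of G, write l for the spectral radius and
   weigh the vertices by y = x^2. If l(G) >= l(S_{k,m}), then
   l^2 - (k-1) l >= m - k^2.

   Cleaning. Choose the induced subgraph G' maximising l^2 - (29/30) |E|. In G'
   every vertex satisfies d(v) <~ 2 l^2 y_v, and l^2 y_v <= d(v) y(N(v)) by
   Cauchy-Schwarz, so every neighbourhood has weight about 1/2. If no single
   weight exceeds a constant, a weighted Kovari-Sos-Turan argument shows that
   adjacent vertices have negligible common neighbourhood; then G' is bipartite
   and l^2 <= m, a contradiction.

   Heavy vertices. If some weight is bounded below, counting two-walks from the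
   vertices of large entry produces a bounded set A, completely joined to a set B
   with |A||B| ~ m, on which x is almost constant and maximal, x being small
   elsewhere. Restricting the eigenvalue equation to A gives
   l^2 y(A) <= l x_A^T Adj(A) x_A + m y(A), whence |A| = k and A is a clique:
   for |A| > k the forbidden graph makes A independent, and otherwise a
   non-clique loses a term linear in l. Applied to G' this shows that only
   boundedly many edges were deleted, so that G itself has a heavy vertex.

   Exact structure. Transplanting x to S_{k,m} and comparing Rayleigh quotients
   turns l(S_{k,m}) <= l(G) into an inequality between the sums of the squared
   weights received from A by the outer vertices. It is decided by the strict
   convexity of j |-> j^2: no edge lies outside A, and at most one outer vertex
   is joined to a proper nonempty part of A. *)

Require Import Defs.
From HB Require Import structures.
From mathcomp Require Import all_boot all_order all_algebra.
From mathcomp Require Import boolp classical_sets reals.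
From mathcomp Require Import topology normedtype derive ring lra zify.
(* Imported again: classical_sets shadows names such as subsetP and inE. *)
From mathcomp Require Import fintype finset.
Set Implicit Arguments. Unset Strict Implicit. Unset Printing Implicit Defensive.
Import Order.TTheory GRing.Theory Num.Theory.
Import numFieldNormedType.Exports.
Local Open Scope ring_scope.

Section FiniteSums.
Variables (R : realFieldType) (I : finType).
Implicit Types (P Q : pred I) (S : {set I}).

Lemma ler_sum_subset P Q (F : I -> R) :
  (forall i, P i -> Q i) -> (forall i, Q i -> 0 <= F i) ->
  \sum_(i | P i) F i <= \sum_(i | Q i) F i.
Proof.
move=> PQ F0; rewrite big_mkcond [leRHS]big_mkcond /=; apply: ler_sum => i _.
by case: ifP => [/PQ -> //|_]; case: ifP => // /F0.
Qed.

Lemma sum_le_card_mul S (F : I -> R) c :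
  {in S, forall i, F i <= c} -> \sum_(i in S) F i <= #|S|%:R * c.
Proof.
by move=> Fc; rewrite mulr_natl -sumr_const; apply: ler_sum => i /Fc.
Qed.

Lemma card_mul_le_sum S (F : I -> R) c :
  {in S, forall i, c <= F i} -> #|S|%:R * c <= \sum_(i in S) F i.
Proof.
by move=> Fc; rewrite mulr_natl -sumr_const; apply: ler_sum => i /Fc.
Qed.

Lemma exists_ge_mean S (F : I -> R) : (0 < #|S|)%N ->
  exists2 i, i \in S & \sum_(j in S) F j <= #|S|%:R * F i.
Proof.
case/card_gt0P => i0 i0S; have [i iS Fmax] := arg_maxP F i0S.
by exists i => //; apply: sum_le_card_mul => j; exact: Fmax.
Qed.

Lemma sumr_setC S (F : I -> R) :
  \sum_i F i = \sum_(i in S) F i + \sum_(i in ~: S) F i.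
Proof.
by rewrite (bigID [in S]) /=; congr (_ + _); apply: eq_bigl => i; rewrite inE.
Qed.

Lemma sum_sqr_ge0 P (a : I -> R) : 0 <= \sum_(i | P i) a i ^+ 2.
Proof. by apply: sumr_ge0 => i _; exact: sqr_ge0. Qed.

Lemma cauchy_schwarz_sum P (a b : I -> R) :
  (\sum_(i | P i) a i * b i) ^+ 2 <=
  (\sum_(i | P i) a i ^+ 2) * (\sum_(i | P i) b i ^+ 2).
Proof.
have lagrange : 0 <= \sum_(i | P i) \sum_(j | P j) (a i * b j - a j * b i) ^+ 2.
  by apply: sumr_ge0 => i _; exact: sum_sqr_ge0.
have expand i j : (a i * b j - a j * b i) ^+ 2 =
    a i ^+ 2 * b j ^+ 2 + b i ^+ 2 * a j ^+ 2 - 2 * (a i * b i * (a j * b j)).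
  by ring.
move: lagrange; under eq_bigr do under eq_bigr do rewrite expand.
under eq_bigr do rewrite !(sumrB, big_split) /= -!mulr_sumr.
rewrite !(sumrB, big_split) /= -mulr_sumr -!mulr_suml; lra.
Qed.

Lemma sqr_sum_le P (a : I -> R) :
  (\sum_(i | P i) a i) ^+ 2 <= #|P|%:R * \sum_(i | P i) a i ^+ 2.
Proof.
have := cauchy_schwarz_sum P (fun=> 1) a.
under eq_bigr do rewrite mul1r.
by under [in X in _ <= X * _]eq_bigr do rewrite expr1n; rewrite sumr_const.
Qed.

(* A reverse Markov inequality. *)
Lemma weighted_sum_le_threshold P (y f : I -> R) (M a : R) :
  (forall i, P i -> 0 <= y i) -> (forall i, P i -> f i <= M) -> 0 <= a ->
  \sum_(i | P i) y i * f i <=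
  M * \sum_(i | P i && (a <= f i)) y i + a * \sum_(i | P i) y i.
Proof.
move=> y0 fM a0; rewrite (bigID (fun i => a <= f i)) /= !mulr_sumr.
apply: lerD.
  by apply: ler_sum => i /andP[Pi _]; rewrite mulrC ler_wpM2r ?y0 ?fM.
apply: (@le_trans _ _ (\sum_(i | P i && ~~ (a <= f i)) a * y i)).
  by apply: ler_sum => i /andP[Pi]; rewrite -ltNge => /ltW fa; rewrite mulrC ler_wpM2r ?y0.
by apply: ler_sum_subset => [i /andP[]|i Pi] //; rewrite mulr_ge0 ?y0.
Qed.

End FiniteSums.

(** * Weighted degrees *)

Section Degrees.
Variables (V : finType) (e : rel V).
Implicit Types (A B S T : {set V}) (u v w : V).

Definition neighbors v : {set V} := [set w | e v w].

Definition deg S v : nat := #|[set w in S | e v w]|.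

Definition arcs S T : nat := \sum_(v in S) deg T v.

Definition clique S : Prop := {in S &, forall p q, p != q -> e p q}.

Definition complete_between S T : Prop := {in S & T, forall a b, e a b}.

Lemma deg_sum1 S v : deg S v = (\sum_(w in S | e v w) 1)%N.
Proof. by rewrite sum1_card; apply: eq_card => w; rewrite inE. Qed.

Lemma deg_le_card S v : (deg S v <= #|S|)%N.
Proof. by apply: subset_leq_card; apply/subsetP => w; rewrite inE => /andP[]. Qed.

Lemma deg_subset S T v : S \subset T -> (deg S v <= deg T v)%N.
Proof.
move=> ST; apply: subset_leq_card; apply/subsetP => w.
by rewrite !inE => /andP[/(subsetP ST) -> ->].
Qed.

Lemma deg_gt0 S v w : w \in S -> e v w -> (0 < deg S v)%N.
Proof. by move=> wS vw; apply/card_gt0P; exists w; rewrite inE wS. Qed.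

Lemma deg_full S v : (forall w, w \in S -> e v w) -> deg S v = #|S|.
Proof.
by move=> vS; apply: eq_card => w; rewrite inE andb_idr // => /vS.
Qed.

Lemma deg_setC S v : deg [set: V] v = (deg S v + deg (~: S) v)%N.
Proof.
rewrite /deg -(cardsID S); congr (_ + _)%N; apply: eq_card => w.
all: by rewrite !inE andbC.
Qed.

Lemma arcs_subset S S' T T' :
  S \subset S' -> T \subset T' -> (arcs S T <= arcs S' T')%N.
Proof.
move=> SS TT; apply: (@leq_trans (\sum_(v in S) deg T' v)).
  by apply: leq_sum => v _; exact: deg_subset.
by rewrite /arcs [leqRHS](big_setID S) /= (setIidPr SS) leq_addr.
Qed.

Lemma arcs_complete S T : complete_between S T -> arcs S T = (#|S| * #|T|)%N.
Proof.
move=> ST; rewrite -sum_nat_const; apply: eq_bigr => v vS.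
by apply: deg_full => w; exact: ST.
Qed.

Lemma arcs_setCr S T : arcs S [set: V] = (arcs S T + arcs S (~: T))%N.
Proof. by rewrite -big_split; apply: eq_bigr => v _; exact: deg_setC. Qed.

Lemma arcs_setCl S T : arcs [set: V] T = (arcs S T + arcs (~: S) T)%N.
Proof. by rewrite /arcs (big_setID S) /= setTI setTD. Qed.

Lemma arcs_clique S : irreflexive e -> clique S -> arcs S S = (#|S| * #|S|.-1)%N.
Proof.
move=> ei Sc; rewrite -sum_nat_const; apply: eq_bigr => p pS.
rewrite (cardsD1 p S) pS; apply: eq_card => q; rewrite !inE.
apply/andP/andP => [[qS pq]|[qp qS]]; split=> //; last by rewrite Sc // eq_sym.
by apply: contraTneq pq => ->; rewrite ei.
Qed.

Lemma arcsC S T : symmetric e -> arcs S T = arcs T S.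
Proof.
move=> es; rewrite /arcs; under eq_bigr do rewrite deg_sum1.
rewrite (exchange_big_dep [in T]) /= => [|v w _ /andP[]//].
by apply: eq_bigr => w wT; rewrite deg_sum1; apply: eq_bigl => v; rewrite wT es.
Qed.

Lemma arcs_split A : symmetric e ->
  arcs [set: V] [set: V] = (arcs A A + 2 * arcs A (~: A) + arcs (~: A) (~: A))%N.
Proof.
by move=> es; rewrite (arcs_setCl A) !(arcs_setCr _ A) (arcsC (~: A) A es); lia.
Qed.

Lemma handshake : simple_graph e -> arcs [set: V] [set: V] = (2 * #|edges e|)%N.
Proof.
move=> [es ei]; pose ends (p : V * V) := [set p.1; p.2].
transitivity (\sum_(p : V * V | e p.1 p.2) 1)%N.
  rewrite /arcs; under eq_bigr do rewrite deg_sum1.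
  by rewrite pair_big_dep; apply: eq_bigl => p; rewrite !inE.
rewrite (partition_big ends [in edges e]) /=; last first.
  by move=> [a b] /= ab; rewrite inE; apply/existsP; exists a; apply/existsP; exists b;
    rewrite ab eqxx.
rewrite mulnC -sum_nat_const; apply: eq_bigr => E.
rewrite inE => /existsP[a /existsP[b /andP[ab /eqP ->]]].
have anb : a != b by apply: contraTneq ab => ->; rewrite ei.
rewrite sum1_card (@eq_card _ _ [set (a, b); (b, a)]).
  by rewrite cards2 xpair_eqE (negbTE anb).
move=> [c d]; rewrite !inE /ends /= !xpair_eqE unfold_in /=.
apply/andP/idP => [[cd /eqP/setP cdE]|/orP[]/andP[/eqP-> /eqP->]].
- have := cdE a; have := cdE b; rewrite !inE !eqxx orbT /=.
  by move=> /orP[]/eqP bE /orP[]/eqP aE; move: anb; rewrite bE aE !eqxx ?orbT.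
- by [].
- by rewrite es ab setUC.
Qed.

Lemma arcs_setC_le A : simple_graph e -> (arcs A (~: A) <= #|edges e|)%N.
Proof.
move=> ge; rewrite -(@leq_pmul2l 2) // -handshake // (arcs_split A); last by case: ge.
by rewrite -addnA addnCA leq_addr.
Qed.

Lemma deg_add_arcs_le A B v : symmetric e -> [disjoint A & B] -> complete_between A B ->
  v \notin A -> v \notin B ->
  (deg [set: V] v + 2 * (#|A| * #|B|) <= arcs [set: V] [set: V])%N.
Proof.
move=> es dAB eAB vA vB; rewrite (arcs_setCl (v |: A)) {1}/arcs big_setU1 //= -/(arcs A _).
have BvA : B \subset ~: (v |: A).
  apply/subsetP => b bB; rewrite !inE negb_or (disjointFl dAB bB) andbT.
  by apply: contraNneq vB => <-.
have := arcs_subset (subxx A) (subsetT B); have := arcs_subset BvA (subsetT A).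
by rewrite (arcsC B A es) (arcs_complete eAB); lia.
Qed.

End Degrees.

Section WeightedDegrees.
Variables (R : realFieldType) (V : finType) (e : rel V).
Implicit Types (S T A : {set V}) (x y z : V -> R) (v w : V).

Definition wdeg y S v : R := \sum_(w in S | e v w) y w.

Definition adj_form x S T : R := \sum_(v in S) x v * wdeg x T v.

Lemma wdeg1 S v : wdeg (fun=> 1) S v = (deg e S v)%:R.
Proof. by rewrite /wdeg sumr_const; congr (_%:R); apply: eq_card => w; rewrite inE. Qed.

Lemma wdegT y v : wdeg y [set: V] v = \sum_(w | e v w) y w.
Proof. by apply: eq_bigl => w; rewrite inE. Qed.

Lemma wdeg_neighbors y S v : wdeg y S v = \sum_(w in S :&: neighbors e v) y w.
Proof. by apply: eq_bigl => w; rewrite !inE. Qed.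

Lemma eq_wdeg y z S v : {in S, y =1 z} -> wdeg y S v = wdeg z S v.
Proof. by move=> yz; apply: eq_bigr => w /andP[wS _]; exact: yz. Qed.

Lemma wdeg_ge0 y S v : {in S, forall w, 0 <= y w} -> 0 <= wdeg y S v.
Proof. by move=> y0; apply: sumr_ge0 => w /andP[/y0]. Qed.

Lemma wdeg_le y z S v : {in S, forall w, y w <= z w} -> wdeg y S v <= wdeg z S v.
Proof. by move=> yz; apply: ler_sum => w /andP[/yz]. Qed.

Lemma wdeg_le_sum y S v : {in S, forall w, 0 <= y w} -> wdeg y S v <= \sum_(w in S) y w.
Proof. by move=> y0; apply: ler_sum_subset => [w /andP[]|w /y0]. Qed.

Lemma wdeg_le_deg y S v c :
  {in S, forall w, y w <= c} -> wdeg y S v <= (deg e S v)%:R * c.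
Proof.
move=> yc; rewrite -wdeg1 mulr_suml; apply: ler_sum => w /andP[/yc].
by rewrite mul1r.
Qed.

Lemma wdegD y z S v : wdeg (fun w => y w + z w) S v = wdeg y S v + wdeg z S v.
Proof. exact: big_split. Qed.

Lemma wdeg_setC y S v : wdeg y [set: V] v = wdeg y S v + wdeg y (~: S) v.
Proof. by rewrite /wdeg (big_setIDcond _ _ S) setTI setTD. Qed.

Lemma wdeg_sqr_le y S v :
  wdeg y S v ^+ 2 <= (deg e S v)%:R * wdeg (fun w => y w ^+ 2) S v.
Proof.
have -> : deg e S v = #|[pred w in S | e v w]| by apply: eq_card => w; rewrite !inE.
exact: sqr_sum_le.
Qed.

Lemma sum_wdeg_exchange y z S T : symmetric e ->
  \sum_(v in S) y v * wdeg z T v = \sum_(w in T) z w * wdeg y S w.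
Proof.
move=> es; under eq_bigr do rewrite mulr_sumr.
rewrite (exchange_big_dep [in T]) /= => [|v w _ /andP[]//].
apply: eq_bigr => w wT; rewrite mulr_sumr; apply: eq_big => [v|v _].
  by rewrite wT es.
exact: mulrC.
Qed.

Lemma sum_wdeg1 S T : \sum_(v in S) wdeg (fun=> 1) T v = (arcs e S T)%:R.
Proof. by rewrite natr_sum; apply: eq_bigr => v _; exact: wdeg1. Qed.

Lemma adj_form_ge0 x S T : (forall v, 0 <= x v) -> 0 <= adj_form x S T.
Proof. by move=> x0; apply: sumr_ge0 => v _; rewrite mulr_ge0 ?wdeg_ge0. Qed.

Lemma adj_formC x S T : symmetric e -> adj_form x S T = adj_form x T S.
Proof. exact: sum_wdeg_exchange. Qed.

Lemma adj_form_setCr x S T :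
  adj_form x S [set: V] = adj_form x S T + adj_form x S (~: T).
Proof.
by rewrite -big_split; apply: eq_bigr => v _ /=; rewrite (wdeg_setC _ T) mulrDr.
Qed.

Lemma adj_form_setCl x S T :
  adj_form x [set: V] T = adj_form x S T + adj_form x (~: S) T.
Proof. by rewrite /adj_form (big_setID S) /= setTI setTD. Qed.

Lemma adj_form_split x A : symmetric e ->
  adj_form x [set: V] [set: V] =
  adj_form x A A + 2 * adj_form x A (~: A) + adj_form x (~: A) (~: A).
Proof.
move=> es; rewrite (adj_form_setCl _ A) !(adj_form_setCr _ _ A) (adj_formC _ (~: A) A es).
ring.
Qed.

Lemma adj_form_sqr_le x S T :
  adj_form x S T ^+ 2 <=
  (arcs e S T)%:R * ((\sum_(v in S) x v ^+ 2) * \sum_(w in T) x w ^+ 2).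
Proof.
have formE : adj_form x S T =
    \sum_(p | (p.1 \in S) && ((p.2 \in T) && e p.1 p.2)) x p.1 * x p.2.
  by rewrite /adj_form; under eq_bigr do rewrite mulr_sumr; rewrite pair_big_dep.
have arcsE : (arcs e S T)%:R =
    #|(fun p : V * V => (p.1 \in S) && ((p.2 \in T) && e p.1 p.2))|%:R :> R.
  by rewrite -sum_wdeg1 pair_big_dep /= sumr_const.
rewrite formE arcsE; apply: le_trans (sqr_sum_le _ _) _; apply: ler_wpM2l => //.
rewrite mulr_suml; under [leRHS]eq_bigr do rewrite mulr_sumr.
rewrite pair_big_dep /=; under eq_bigr do rewrite exprMn.
apply: ler_sum_subset => [[v w] /= /and3P[-> -> _] //|p _].
by rewrite mulr_ge0 ?sqr_ge0.
Qed.

End WeightedDegrees.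

(** * The Perron vector *)

Section RayleighQuotient.
Variables (R : realType) (n : nat) (M : 'M[R]_n).
Implicit Types u v : 'rV[R]_n.

Definition dot u v : R := (u *m v^T) 0 0.

Definition qform u : R := dot (u *m M) u.

Lemma dotE u v : dot u v = \sum_i u 0 i * v 0 i.
Proof. by rewrite /dot mxE; apply: eq_bigr => i _; rewrite mxE. Qed.

Lemma dotC u v : dot u v = dot v u.
Proof. by rewrite !dotE; apply: eq_bigr => i _; rewrite mulrC. Qed.

Lemma dotDl u v w : dot (u + v) w = dot u w + dot v w.
Proof. by rewrite /dot mulmxDl mxE. Qed.

Lemma dotZl a u v : dot (a *: u) v = a * dot u v.
Proof. by rewrite /dot -scalemxAl mxE. Qed.

Lemma dotDr u v w : dot u (v + w) = dot u v + dot u w.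
Proof. by rewrite !(dotC u) dotDl. Qed.

Lemma dotZr a u v : dot u (a *: v) = a * dot u v.
Proof. by rewrite !(dotC u) dotZl. Qed.

Lemma dot_ge0 u : 0 <= dot u u.
Proof. by rewrite dotE; apply: sumr_ge0 => i _; rewrite -expr2 sqr_ge0. Qed.

Lemma dot_eq0 u : (dot u u == 0) = (u == 0).
Proof.
apply/eqP/eqP => [|->]; last by rewrite /dot mul0mx mxE.
rewrite dotE => /psumr_eq0P z; apply/rowP => i; rewrite mxE.
have /eqP := z (fun j _ => sqr_ge0 (u 0 j)) i isT.
by rewrite mulf_eq0 orbb => /eqP.
Qed.

Lemma dot_gt0 u : u != 0 -> 0 < dot u u.
Proof. by rewrite -dot_eq0 lt_def dot_ge0 andbT. Qed.

Lemma dot_mulmx_sym u v : M^T = M -> dot (u *m M) v = dot (v *m M) u.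
Proof. by move=> Ms; rewrite dotC /dot trmx_mul Ms mulmxA. Qed.

Lemma qformZ a u : qform (a *: u) = a ^+ 2 * qform u.
Proof. by rewrite /qform -scalemxAl dotZl dotZr mulrA -expr2. Qed.

Lemma continuous_dot : continuous (fun u => dot u u).
Proof.
rewrite (_ : (fun u => dot u u) = fun u => \sum_i u 0 i * u 0 i); last first.
  by apply/funext => u; exact: dotE.
apply: (continuous_big add_continuous) => i _ u.
by have coord := @coord_continuous R 1 n 0 i u; exact: (cvgM coord coord).
Qed.

Lemma continuous_qform : continuous qform.
Proof.
rewrite (_ : qform = fun u => \sum_j (\sum_i u 0 i * M i j) * u 0 j); last first.
  by apply/funext => u; rewrite /qform dotE; apply: eq_bigr => j _; rewrite mxE.
apply: (continuous_big add_continuous) => j _ u.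
apply: (cvgM _ (@coord_continuous R 1 n 0 j u)).
move: u; apply: (continuous_big add_continuous) => i _ u.
exact: (cvgM (@coord_continuous R 1 n 0 i u) (cvg_cst _)).
Qed.

Lemma compact_unit_sphere : compact [set u | dot u u = 1]%classic.
Proof.
apply: bounded_closed_compact; last first.
  apply: (@preimage_closed _ _ (fun u => dot u u) [set 1]%classic).
    by move=> u _; exact: continuous_dot.
  exact: closed_eq.
exists 1; split=> // c c1 u /= u1.
rewrite /Num.norm /= mx_normrE; apply: bigmax_le => [|[i j] _ /=].
  by rewrite (le_trans _ (ltW c1)).
apply: le_trans (ltW c1); rewrite (ord1 i) -(@ler_pXn2r _ 2) // ?nnegrE //.
rewrite real_normK ?num_real // expr1n -u1 dotE (bigD1 j) //= lerDl.
by apply: sumr_ge0 => k _; rewrite -expr2 sqr_ge0.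
Qed.

Lemma qform_max : (0 < n)%N -> exists2 u, dot u u = 1 &
  forall v, qform v <= qform u * dot v v.
Proof.
move=> n0; have sphere0 : ([set u | dot u u = 1] !=set0)%classic.
  exists (delta_mx 0 (Ordinal n0)) => /=.
  rewrite dotE (bigD1 (Ordinal n0)) //= big1 => [|i ni]; rewrite !mxE ?eqxx.
    by rewrite mulr1 addr0.
  by rewrite (negbTE ni) mulr0.
have [u /set_mem u1 umax] :=
  EVT_max_rV sphere0 compact_unit_sphere (continuous_subspaceT continuous_qform).
exists u => // v; have [->|v0] := eqVneq v 0.
  by rewrite -(scale0r u) qformZ dotZl expr0n /= !mul0r mulr0.
have vv := dot_gt0 v0; pose s := (Num.sqrt (dot v v))^-1.
have s2 : s ^+ 2 = (dot v v)^-1 by rewrite exprVn sqr_sqrtr ?ltW.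
have : qform (s *: v) <= qform u.
  by apply/umax/mem_set; rewrite /= dotZl dotZr mulrA -expr2 s2 mulVf ?gt_eqF.
by rewrite qformZ s2 mulrC ler_pdivrMr.
Qed.

Lemma eq0_of_le_sqr (a b : R) : (forall s, s * a <= s ^+ 2 * b) -> a = 0.
Proof.
move=> ab; apply/eqP/negPn/negP => a0.
pose c := `|b| + 1; have c0 : 0 < c by rewrite ltr_wpDl.
have bc : b < c by rewrite (le_lt_trans (ler_norm b)) // ltrDl.
have := ab (a / c); rewrite leNgt -subr_gt0.
have -> : a / c * a - (a / c) ^+ 2 * b = (a / c) ^+ 2 * (c - b) by field; rewrite gt_eqF.
by rewrite mulr_gt0 ?subr_gt0 // exprn_even_gt0 //= mulf_neq0 // invr_eq0 gt_eqF.
Qed.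

Lemma qform_max_eigen u l : M^T = M -> dot u u = 1 -> qform u = l ->
  (forall v, qform v <= l * dot v v) -> u *m M = l *: u.
Proof.
move=> Ms u1 ul umax; pose w := u *m M - l *: u.
have wE : u *m M = w + l *: u by rewrite subrK.
clearbody w; suff /eqP : dot w w = 0 by rewrite dot_eq0 wE => /eqP ->; rewrite add0r.
have perturb (s : R) : s * (2 * dot w w) <= s ^+ 2 * (l * dot w w - qform w).
  have := umax (u + s *: w).
  rewrite /qform mulmxDl -scalemxAl !(dotDl, dotDr, dotZl, dotZr) u1 -/(qform u) ul.
  rewrite (dot_mulmx_sym w u Ms) -/(qform w) (dotC w u).
  have -> : dot (u *m M) w = dot w w + l * dot u w by rewrite wE dotDl dotZl.
  lra.
by have := eq0_of_le_sqr perturb; lra.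
Qed.

Lemma qform_eigen u a : u *m M = a *: u -> qform u = a * dot u u.
Proof. by rewrite /qform => ->; rewrite dotZl. Qed.

Lemma qform_le_norm u : (forall i j, 0 <= M i j) ->
  `|qform u| <= qform (\row_i `|u 0 i|).
Proof.
move=> M0; rewrite /qform !dotE; apply: le_trans (ler_norm_sum _ _ _) _.
apply: ler_sum => j _; rewrite normrM !mxE ler_wpM2r //.
apply: le_trans (ler_norm_sum _ _ _) _; apply: ler_sum => i _.
by rewrite normrM mxE (ger0_norm (M0 i j)).
Qed.

Lemma dot_norm u : dot (\row_i `|u 0 i|) (\row_i `|u 0 i|) = dot u u.
Proof.
rewrite !dotE; apply: eq_bigr => i _.
by rewrite !mxE -!expr2 real_normK ?num_real.
Qed.

(* Taking absolute values of the coordinates of a maximiser of the quadratic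
   form on the unit sphere does not decrease the form. *)
Lemma nonneg_symmetric_perron : (0 < n)%N -> M^T = M -> (forall i j, 0 <= M i j) ->
  exists u l, [/\ forall i, 0 <= u 0 i, dot u u = 1, u *m M = l *: u,
    forall v, qform v <= l * dot v v & forall a, eigenvalue M a -> `|a| <= l].
Proof.
move=> n0 Ms M0; have [u0 u1 umax] := qform_max n0.
pose u : 'rV_n := \row_i `|u0 0 i|; pose l := qform u0.
have u1' : dot u u = 1 by rewrite dot_norm.
have ul : qform u = l.
  apply/eqP; rewrite eq_le (le_trans (ler_norm _) (qform_le_norm u0 M0)) andbT.
  by have := umax u; rewrite u1' mulr1.
exists u, l; split=> // [i||a /eigenvalueP[v va v0]]; first by rewrite mxE.
  exact: qform_max_eigen.
rewrite -(ler_pM2r (dot_gt0 v0)) -{1}(ger0_norm (dot_ge0 v)) -normrM -(qform_eigen va).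
by apply: le_trans (qform_le_norm v M0) _; rewrite -[dot v v]dot_norm.
Qed.

End RayleighQuotient.

Section Perron.
Variables (R : realFieldType) (V : finType) (e : rel V).

Definition perron (l : R) (x : V -> R) : Prop :=
  [/\ forall v, 0 <= x v, \sum_v x v ^+ 2 = 1 &
      forall v, l * x v = wdeg e x [set: V] v].

Variables (l : R) (x : V -> R).
Hypothesis px : perron l x.

Lemma perron_ge0 v : 0 <= x v.
Proof. by case: px. Qed.

Lemma perron_eigen v : l * x v = wdeg e x [set: V] v.
Proof. by case: px. Qed.

Lemma perron_sum_setC (A : {set V}) :
  \sum_(v in A) x v ^+ 2 + \sum_(v in ~: A) x v ^+ 2 = 1.
Proof. by case: px => _ <- _; rewrite -sumr_setC. Qed.

Lemma perron_sum_le1 (P : pred V) : \sum_(v | P v) x v ^+ 2 <= 1.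
Proof. by case: px => _ <- _; apply: ler_sum_subset => // v _; exact: sqr_ge0. Qed.

Lemma perron_sqr_le1 v : x v ^+ 2 <= 1.
Proof. by have := perron_sum_le1 (pred1 v); rewrite big_pred1_eq. Qed.

Lemma perron_adj_form : adj_form e x [set: V] [set: V] = l.
Proof.
rewrite /adj_form; under eq_bigr do rewrite -perron_eigen mulrCA -expr2.
rewrite -mulr_sumr (eq_bigl predT) => [|v]; last by rewrite inE.
by case: px => _ -> _; rewrite mulr1.
Qed.

Lemma perron_spec_ge0 : 0 <= l.
Proof. by rewrite -perron_adj_form adj_form_ge0 //; exact: perron_ge0. Qed.

Lemma perron_sqr_le v : l ^+ 2 * x v ^+ 2 <=
  (deg e [set: V] v)%:R * wdeg e (fun w => x w ^+ 2) [set: V] v.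
Proof. by rewrite -exprMn perron_eigen; exact: wdeg_sqr_le. Qed.

Lemma perron_sqr_le_deg v : l ^+ 2 * x v ^+ 2 <= (deg e [set: V] v)%:R.
Proof.
apply: le_trans (perron_sqr_le v) _.
by rewrite ler_piMr // perron_sum_le1.
Qed.

Lemma perron_sqr_le_edges : simple_graph e -> l ^+ 2 <= 2 * #|edges e|%:R.
Proof.
move=> ge; rewrite -[2 in leRHS]/(2%:R) -natrM -handshake // -{1}perron_adj_form.
apply: le_trans (adj_form_sqr_le _ _ _ _) _.
by rewrite ler_piMr // mulr_ile1 ?sum_sqr_ge0 ?perron_sum_le1.
Qed.

(* The two sides have weights [a] and [1 - a], and [a * (1 - a) <= 1/4]. *)
Lemma perron_sqr_le_bipartite (P : {set V}) : simple_graph e ->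
  (forall u v, e u v -> (u \in P) != (v \in P)) -> l ^+ 2 <= #|edges e|%:R.
Proof.
move=> ge bip; have [es _] := ge.
have inside (S : {set V}) v : {in S, forall w, e v w -> (v \in S) != (w \in S)} ->
    v \in S -> wdeg e x S v = 0.
  by move=> bS vS; apply: big1 => w /andP[wS /(bS w wS)]; rewrite vS wS.
have formP : adj_form e x P P = 0.
  by rewrite /adj_form big1 // => v vP; rewrite inside ?mulr0 // => w _ /bip.
have formC : adj_form e x (~: P) (~: P) = 0.
  rewrite /adj_form big1 // => v vP; rewrite inside ?mulr0 // => w _ /bip.
  by rewrite !inE (inj_eq negb_inj).
have lE : l = 2 * adj_form e x P (~: P).
  by rewrite -perron_adj_form (adj_form_split _ P es) formP formC add0r addr0.
have arcs_le : (arcs e P (~: P))%:R <= #|edges e|%:R :> R.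
  by rewrite ler_nat arcs_setC_le.
have := adj_form_sqr_le e x P (~: P); have := perron_sum_setC P.
rewrite lE exprMn; set a := \sum_(v in P) _; set b := \sum_(v in _) _ => ab1 form_le.
have ab : a * b <= 1 / 4.
  have -> : b = 1 - a by lra.
  by have := sqr_ge0 (a - 1 / 2); lra.
have := ler_wpM2l (ler0n R (arcs e P (~: P))) ab; lra.
Qed.

End Perron.

(** * The spectral radius *)

Section AdjacencyMatrix.
Variables (R : realType) (V : finType) (e : rel V).
Hypothesis es : symmetric e.
Implicit Types x y : V -> R.

Definition row_of x : 'rV[R]_#|V| := \row_i x (enum_val i).

Lemma row_of_enum_rank (u : 'rV[R]_#|V|) : row_of (fun v => u 0 (enum_rank v)) = u.
Proof. by apply/rowP => i; rewrite mxE enum_valK. Qed.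

Lemma sum_enum_val (F : V -> R) : \sum_(i < #|V|) F (enum_val i) = \sum_v F v.
Proof. by rewrite [RHS](reindex (@enum_val V predT)) //; exact/onW_bij/enum_val_bij. Qed.

Lemma dot_row_of x y : dot (row_of x) (row_of y) = \sum_v x v * y v.
Proof. by rewrite dotE -sum_enum_val; apply: eq_bigr => i _; rewrite !mxE. Qed.

Lemma row_of_mulmx_adjmx x : row_of x *m adjmx R e = row_of (wdeg e x [set: V]).
Proof.
apply/rowP => i; rewrite !mxE wdegT [RHS]big_mkcond -sum_enum_val.
by apply: eq_bigr => j _; rewrite !mxE es; case: (e _ _); rewrite ?mulr1 ?mulr0.
Qed.

Lemma qform_row_of x : qform (adjmx R e) (row_of x) = adj_form e x [set: V] [set: V].
Proof.
rewrite /qform row_of_mulmx_adjmx dot_row_of.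
by apply: eq_big => [v|v _]; rewrite ?inE // mulrC.
Qed.

Lemma adjmx_sym : (adjmx R e)^T = adjmx R e.
Proof. by apply/matrixP => i j; rewrite !mxE es. Qed.

Lemma spec_rad_perron : (0 < #|V|)%N ->
  (exists x, perron e (spec_rad R e) x) /\
  (forall y, adj_form e y [set: V] [set: V] <= spec_rad R e * \sum_v y v ^+ 2).
Proof.
move=> V0; have [|u [l [u0 u1 ul lmax lub]]] := nonneg_symmetric_perron V0 adjmx_sym.
  by move=> i j; rewrite mxE.
pose x v := u 0 (enum_rank v); have uE : row_of x = u := row_of_enum_rank u.
have l0 : 0 <= l by apply: le_trans (lub l _); [|apply/eigenvalueP; exists u => //];
  rewrite -?dot_eq0 ?u1 ?oner_eq0.
pose moduli := [set `|a| | a in [set a : R | eigenvalue (adjmx R e) a]]%classic.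
have l_modulus : moduli l.
  exists l; last exact: ger0_norm.
  by apply/eigenvalueP; exists u => //; rewrite -dot_eq0 u1 oner_eq0.
have l_ub : ubound moduli l by move=> _ [a /= /lub al <-].
have -> : spec_rad R e = l.
  apply/eqP; rewrite eq_le; apply/andP; split; first by apply: ge_sup l_ub; exists l.
  by apply: ub_le_sup => //; exists l.
split=> [|y].
  exists x; split=> [v||v]; first exact: u0.
    by rewrite -[RHS]u1 -uE dot_row_of; apply: eq_bigr => v _; rewrite expr2.
  have /rowP/(_ (enum_rank v)) := row_of_mulmx_adjmx x.
  by rewrite uE ul !mxE enum_rankK.
by rewrite -qform_row_of; apply: le_trans (lmax _) _; rewrite dot_row_of.
Qed.

Lemma spec_rad_empty : #|V| = 0%N -> spec_rad R e = 0.
Proof.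
move=> V0; rewrite /spec_rad -(sup0 R); congr sup.
rewrite -classical_sets.subset0 => _ [a /= /eigenvalueP[u _ /eqP u_neq0] _]; apply: u_neq0.
by apply/rowP => i; have := ltn_ord i; rewrite [X in (_ < X)%N]V0 ltn0.
Qed.

Lemma adj_form_le_spec_rad y :
  adj_form e y [set: V] [set: V] <= spec_rad R e * \sum_v y v ^+ 2.
Proof.
have [V0|V0] := posnP #|V|; last by case: (spec_rad_perron V0).
rewrite spec_rad_empty // mul0r /adj_form big1 // => v _.
by move/card0_eq/(_ v): V0; rewrite inE.
Qed.

Lemma spec_rad_ge0 : 0 <= spec_rad R e.
Proof.
have [V0|V0] := posnP #|V|; first by rewrite spec_rad_empty.
by have [[x px] _] := spec_rad_perron V0; exact: perron_spec_ge0 px.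
Qed.

End AdjacencyMatrix.

Lemma nonisol_left (V : finType) (e : rel V) v w : e v w -> v \in nonisol e.
Proof. by move=> vw; rewrite inE; apply/existsP; exists w. Qed.

Section Pushforward.
Variables (R : realFieldType) (V W : finType) (e : rel V) (e' : rel W) (phi : V -> W).
Variable x : V -> R.
Let N := nonisol e.
Hypotheses (es : symmetric e) (phi_inj : {in N &, injective phi}).
Hypotheses (phi_hom : forall u v, e u v -> e' (phi u) (phi v)) (x0 : forall v, 0 <= x v).

Definition pushforward (w : W) : R := \sum_(v in N | phi v == w) x v.

Lemma pushforward_ge0 w : 0 <= pushforward w.
Proof. exact: sumr_ge0. Qed.

Lemma pushforward_image v : v \in N -> pushforward (phi v) = x v.
Proof.
move=> vN; rewrite /pushforward (bigD1 v) ?vN ?eqxx //= big1 ?addr0 // => u.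
by case/andP => /andP[uN /eqP/(phi_inj uN vN) ->]; rewrite eqxx.
Qed.

Lemma sum_sqr_pushforward_le : \sum_w pushforward w ^+ 2 <= \sum_v x v ^+ 2.
Proof.
rewrite (sumr_setC (phi @: N)) [X in _ + X]big1 => [|w]; last first.
  rewrite inE => wN; rewrite /pushforward big1 ?expr0n // => v /andP[vN /eqP vw].
  by case/negP: wN; rewrite -vw imset_f.
rewrite addr0 big_imset //= (eq_bigr (fun v => x v ^+ 2)) => [|v /pushforward_image ->//].
by apply: ler_sum_subset => // v _; exact: sqr_ge0.
Qed.

Lemma adj_form_pushforward_ge :
  adj_form e x [set: V] [set: V] <= adj_form e' pushforward [set: W] [set: W].
Proof.
have wdeg_out v S : v \notin N -> wdeg e x S v = 0.
  by move=> vN; apply: big1 => w /andP[_ /nonisol_left vw]; rewrite vw in vN.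
rewrite (adj_form_setCl _ _ N) [X in _ + X]big1 ?addr0 => [|v]; last first.
  by rewrite inE => /wdeg_out ->; rewrite mulr0.
apply: (@le_trans _ _ (adj_form e' pushforward (phi @: N) (phi @: N))); last first.
  rewrite (adj_form_setCl _ _ (phi @: N)) (adj_form_setCr _ _ _ (phi @: N)) -addrA.
  by rewrite lerDl addr_ge0 ?adj_form_ge0 //; exact: pushforward_ge0.
rewrite /adj_form big_imset //=; apply: ler_sum => v vN; rewrite pushforward_image //.
rewrite ler_wpM2l // /wdeg big_imset_cond //=.
rewrite [leRHS](eq_bigr x) => [|w /andP[/pushforward_image ->]//].
apply: ler_sum_subset => // w /andP[_ vw].
by rewrite phi_hom // (@nonisol_left _ _ w v) // es.
Qed.

End Pushforward.

Section Embeddings.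
Variable R : realType.

Lemma spec_rad_mono (V W : finType) (e : rel V) (e' : rel W) (phi : V -> W) :
  symmetric e -> symmetric e' -> {in nonisol e &, injective phi} ->
  (forall u v, e u v -> e' (phi u) (phi v)) -> spec_rad R e <= spec_rad R e'.
Proof.
move=> es es' phi_inj phi_hom.
have [V0|V0] := posnP #|V|; first by rewrite spec_rad_empty ?spec_rad_ge0.
have [[x px] _] := spec_rad_perron R es V0.
rewrite -[leLHS](perron_adj_form px).
apply: le_trans (adj_form_pushforward_ge es phi_inj phi_hom (perron_ge0 px)) _.
apply: le_trans (adj_form_le_spec_rad es' _) _; rewrite ler_piMr ?spec_rad_ge0 //.
apply: le_trans (sum_sqr_pushforward_le x phi_inj) _.
exact: perron_sum_le1 px _.
Qed.

Lemma same_graph_sym (V W : finType) (e : rel V) (e' : rel W) (v0 : V) :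
  same_graph e e' -> same_graph e' e.
Proof.
move=> [phi [phi_inj [phi_im phi_hom]]].
pose psi w := odflt v0 [pick v in nonisol e | phi v == w].
have psiK w : w \in nonisol e' -> psi w \in nonisol e /\ phi (psi w) = w.
  rewrite -phi_im => /imsetP[v vN ->]; rewrite /psi.
  by case: pickP => [u /andP[uN /eqP]|/(_ v)] //; rewrite vN eqxx.
have phiK v : v \in nonisol e -> psi (phi v) = v.
  move=> vN; have [|pN phipsi] := psiK (phi v); first by rewrite -phi_im imset_f.
  exact: phi_inj.
exists psi; split; last split.
- by move=> a b /psiK[_ {2}<-] /psiK[_ {2}<-] ->.
- apply/setP => v; apply/imsetP/idP => [[w /psiK[? _] -> //]|vN].
  by exists (phi v); rewrite ?phiK // -phi_im imset_f.
- by move=> a b /psiK[aN {2}<-] /psiK[bN {2}<-]; rewrite phi_hom.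
Qed.

Lemma same_graph_spec_rad_le (V W : finType) (e : rel V) (e' : rel W) :
  symmetric e -> symmetric e' -> same_graph e e' -> spec_rad R e <= spec_rad R e'.
Proof.
move=> es es' [phi [phi_inj [_ phi_hom]]]; apply: spec_rad_mono (phi_inj) _ => // u v uv.
by rewrite phi_hom // (nonisol_left uv, @nonisol_left _ e v u) // es.
Qed.

Lemma same_graph_spec_rad (V W : finType) (e : rel V) (e' : rel W) (v0 : V) :
  symmetric e -> symmetric e' -> same_graph e e' -> spec_rad R e = spec_rad R e'.
Proof.
move=> es es' ee'; apply: le_anti; rewrite !same_graph_spec_rad_le //.
exact: same_graph_sym v0 ee'.
Qed.

Lemma same_graph_of_embedding (V W : finType) (e : rel V) (e' : rel W) (psi : W -> V) :
  symmetric e' -> {in nonisol e' &, injective psi} ->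
  {in nonisol e' &, forall a b, e (psi a) (psi b) = e' a b} ->
  {subset nonisol e <= psi @: nonisol e'} -> same_graph e' e.
Proof.
move=> es' psi_inj psi_hom covered; exists psi; split=> //; split=> //.
apply/setP => v; apply/idP/idP => [/imsetP[a aN ->]|/covered //].
move: (aN); rewrite inE => /existsP[b ab]; apply: (@nonisol_left _ _ _ (psi b)).
by rewrite psi_hom // (@nonisol_left _ _ b a) // es'.
Qed.

End Embeddings.

Section InducedSubgraphs.
Variables (V : finType) (e : rel V).
Implicit Types S T : {set V}.

Definition induced S : rel V := fun u v => [&& u \in S, v \in S & e u v].

Lemma induced_simple S : simple_graph e -> simple_graph (induced S).
Proof.
by move=> [es ei]; split=> [u v|u]; rewrite /induced ?ei ?andbF // es andbCA.
Qed.

Lemma induced_F_free (W : finType) (f : rel W) S : F_free f e -> F_free f (induced S).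
Proof.
move=> ff [phi [phi_inj phi_hom]]; apply: ff; exists phi; split=> // a b.
by move=> /phi_hom/and3P[].
Qed.

Lemma inducedT : induced [set: V] = e.
Proof. by apply/funext => u; apply/funext => v; rewrite /induced !in_setT. Qed.

Lemma deg_induced S T v : v \in T -> deg (induced T) S v = deg e (S :&: T) v.
Proof.
by move=> vT; apply: eq_card => w; rewrite !inE /induced vT /= andbA.
Qed.

Lemma arcs_induced S : arcs (induced S) [set: V] [set: V] = arcs e S S.
Proof.
rewrite (arcs_setCl _ S) [X in (_ + X)%N]big1 ?addn0 => [|v]; last first.
  by rewrite inE => /negbTE vS; apply: eq_card0 => w; rewrite !inE /induced vS.
by apply: eq_bigr => v vS; rewrite deg_induced // setTI.
Qed.

Lemma edges_induced_le S : simple_graph e -> (#|edges (induced S)| <= #|edges e|)%N.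
Proof.
move=> ge; have ge' := induced_simple S ge.
by rewrite -(@leq_pmul2l 2) // -!handshake // arcs_induced arcs_subset.
Qed.

Lemma adj_form_induced (R : realFieldType) (x : V -> R) S :
  adj_form (induced S) x [set: V] [set: V] = adj_form e x S S.
Proof.
rewrite (adj_form_setCl _ _ S) [X in _ + X]big1 ?addr0 => [|v]; last first.
  rewrite inE => /negbTE vS; rewrite /wdeg big1 ?mulr0 // => w.
  by rewrite /induced vS andbF.
apply: eq_bigr => v vS; congr (_ * _); apply: eq_bigl => w.
by rewrite inE /induced vS.
Qed.

Lemma spec_rad_induced_le (R : realType) S : simple_graph e ->
  spec_rad R (induced S) <= spec_rad R e.
Proof.
move=> ge; apply: (@spec_rad_mono _ _ _ _ _ id) => //.
- by case: (induced_simple S ge).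
- by case: ge.
- by move=> u v /and3P[].
Qed.

End InducedSubgraphs.

(** * Graphs without heavy vertices *)

Section ForbiddenSubgraph.
Variables (k t : nat) (V : finType) (e : rel V).
Hypotheses (ge : simple_graph e) (k0 : (0 < k)%N).

Lemma Kplus_subgraph (u v : V) (K Y : {set V}) :
  (k.-1 <= #|K|)%N -> (t < #|Y|)%N -> u \notin K -> v \notin K -> e u v ->
  complete_between e (u |: (v |: K)) Y -> has_subgraph (@Kplus_rel k t) e.
Proof.
move=> kK tY uK vK uv KY; have [es ei] := ge.
have u_neq_v : u != v by apply: contraTneq uv => ->; rewrite ei.
pose s := [:: u, v & enum K].
have s_uniq : uniq s by rewrite /= !inE !mem_enum negb_or u_neq_v uK vK enum_uniq.
have lt_s (i : 'I_k.+1) : (i < size s)%N.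
  by rewrite /= -cardE; case: i => i /= ik; lia.
have lt_Y (j : 'I_t.+1) : (j < size (enum Y))%N.
  by rewrite -cardE; case: j => j /= jt; lia.
pose phi (a : 'I_k.+1 + 'I_t.+1) :=
  match a with inl i => nth u s i | inr j => nth u (enum Y) j end.
have phi_edge i j : e (phi (inl i)) (phi (inr j)).
  apply: KY; last by rewrite -mem_enum mem_nth.
  by have := mem_nth u (lt_s i); rewrite !inE mem_enum.
exists phi; split=> [[i|j] [i'|j'] /eqP|[i|j] [i'|j'] //=].
- by rewrite /phi nth_uniq // => /eqP/val_inj ->.
- by move=> /eqP E; have := phi_edge i j'; rewrite E ei.
- by move=> /eqP E; have := phi_edge i' j; rewrite E ei.
- by rewrite /phi nth_uniq ?enum_uniq // => /eqP/val_inj ->.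
- by case/orP => /andP[/eqP -> /eqP ->]; rewrite // es.
- by move=> _; exact: phi_edge.
- by move=> _; rewrite es; exact: phi_edge.
Qed.

Lemma Kplus_free_independent (A B : {set V}) (p q : V) :
  F_free (@Kplus_rel k t) e -> (k < #|A|)%N -> (t < #|B|)%N ->
  complete_between e A B -> p \in A -> q \in A -> ~~ e p q.
Proof.
move=> Ff kA tB AB pA qA; apply/negP => pq; apply: Ff.
apply: (@Kplus_subgraph p q (A :\: [set p; q]) B) => //.
- rewrite cardsD; have := subset_leq_card (subsetIr A [set p; q]).
  by rewrite cards2; case: (p != q) => /=; lia.
- by rewrite !inE eqxx.
- by rewrite !inE eqxx orbT.
- by move=> a b aA; apply: AB; move: aA; rewrite !inE => /or3P[/eqP->|/eqP->|/andP[]].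
Qed.

End ForbiddenSubgraph.

Section WeightedKST.
Variables (R : realFieldType) (V : finType) (e : rel V) (y : V -> R).
Hypotheses (es : symmetric e) (y0 : forall v, 0 <= y v).
Implicit Types C Q E : {set V}.

Definition trace Q c : {set V} := [set w in Q | e c w].

(* Pigeonhole over the [2 ^ #|Q|] possible traces. *)
Lemma common_trace C Q (t : nat) (eta : R) :
  {in C, forall c, y c <= eta} -> 0 <= eta ->
  (2 ^ #|Q| * t)%:R * eta < \sum_(c in C) y c ->
  exists E : {set V}, (t < #|[set c in C | trace Q c == E]|)%N.
Proof.
move=> yeta eta0 heavy.
have [/existsP[E tE]|] := boolP [exists E, t < #|[set c in C | trace Q c == E]|]%N.
  by exists E.
rewrite negb_exists => /forallP small; exfalso.
move: heavy; rewrite ltNge => /negP; apply.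
rewrite (partition_big (trace Q) [in powerset Q]) /=; last first.
  by move=> c _; rewrite powersetE; apply/subsetP => w /[!inE] /andP[].
rewrite natrM -card_powerset -mulrA; apply: sum_le_card_mul => E _.
pose D := [set c in C | trace Q c == E].
apply: (@le_trans _ _ (#|D|%:R * eta)); last first.
  by rewrite ler_wpM2r // ler_nat leqNgt small.
rewrite (eq_bigl [in D]) => [|c]; last by rewrite inE.
by apply: sum_le_card_mul => c; rewrite inE => /andP[/yeta].
Qed.

Lemma weighted_KST C Q (s t : nat) (alpha eta : R) :
  {in Q, forall q, alpha * \sum_(c in C) y c <= wdeg e y C q} ->
  {in C, forall c, y c <= eta} -> 0 <= eta ->
  (2 ^ #|Q| * t)%:R * eta * #|Q|%:R < (#|Q|%:R * alpha - s%:R) * \sum_(c in C) y c ->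
  exists K D : {set V}, [/\ K \subset Q, D \subset C, (s <= #|K|)%N, (t < #|D|)%N &
    complete_between e K D].
Proof.
move=> Qdeg yeta eta0 large; set yC := \sum_(c in C) y c in Qdeg large.
pose C' := [set c in C | s%:R <= (deg e Q c)%:R :> R].
have many : #|Q|%:R * (alpha * yC) <= #|Q|%:R * (\sum_(c in C') y c) + s%:R * yC.
  apply: le_trans (card_mul_le_sum Qdeg) _.
  have -> : \sum_(c in C') y c = \sum_(c in C | s%:R <= (deg e Q c)%:R :> R) y c.
    by apply: eq_bigl => c; rewrite inE.
  have -> : \sum_(q in Q) wdeg e y C q = \sum_(c in C) y c * (deg e Q c)%:R.
    have := sum_wdeg_exchange (fun=> 1) y Q C es.
    under eq_bigr do rewrite mul1r.
    by move=> ->; apply: eq_bigr => c _; rewrite wdeg1.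
  by apply: weighted_sum_le_threshold => // c _; rewrite ler_nat deg_le_card.
have [E tE] : exists E : {set V}, (t < #|[set c in C' | trace Q c == E]|)%N.
  apply: (@common_trace _ _ _ eta) => // [c|]; first by rewrite inE => /andP[/yeta].
  have Q0 : 0 < #|Q|%:R :> R.
    rewrite lt_def ler0n andbT; apply: contraTneq large => Q0.
    by rewrite Q0 mulr0 mul0r add0r -leNgt mulNr oppr_le0 mulr_ge0 // sumr_ge0.
  by rewrite -(ltr_pM2r Q0); apply: lt_le_trans large _; lra.
set D := [set c in _ | _] in tE; have [c cD] : exists c, c \in D.
  by apply/card_gt0P; apply: leq_ltn_trans tE.
exists E, D; split=> //.
- by move: cD; rewrite !inE => /andP[_ /eqP <-]; apply/subsetP => w /[!inE] /andP[].
- by apply/subsetP => d; rewrite !inE => /andP[/andP[]].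
- by move: cD; rewrite !inE ler_nat => /andP[/andP[_ sQ] /eqP <-].
- move=> w d wE; rewrite !inE => /andP[_ /eqP dE].
  by move: wE; rewrite -dE inE es => /andP[].
Qed.

End WeightedKST.

Lemma subset_of_card (V : finType) (A : {set V}) n : (n <= #|A|)%N ->
  exists2 B : {set V}, B \subset A & #|B| = n.
Proof.
move=> /card_geqP[s [s_uniq size_s sA]]; exists [set:: s].
  by apply/subsetP => v; rewrite inE => /sA.
by rewrite cardsE -size_s; exact/card_uniqP.
Qed.

Section LightVertices.
Variables (R : realFieldType) (V : finType) (e : rel V) (y : V -> R) (delta : R).
Hypotheses (ge : simple_graph e) (y0 : forall v, 0 <= y v) (y1 : \sum_v y v = 1).
Hypotheses (delta0 : 0 < delta) (delta_le : 26 * delta <= 1).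
Hypothesis half_neighbors :
  forall u v, e u v -> 1 / 2 - delta <= \sum_(c in neighbors e u) y c.
Let mass (S : {set V}) := \sum_(v in S) y v.

Lemma many_heavy_codegrees (C : {set V}) (eta : R) :
  {in C, forall c, exists u, e c u} -> (forall v, y v <= eta) ->
  0 < mass C -> 1 / 4 <= eta * #|[set w | mass C / 6 <= wdeg e y C w]|%:R.
Proof.
move=> C_edge yeta C0; have [es _] := ge.
set W := [set w | _ <= _].
have total : (1 / 2 - delta) * mass C <= \sum_w y w * wdeg e y C w.
  rewrite -(eq_bigl _ _ (fun w => in_setT w)) sum_wdeg_exchange // mulr_sumr.
  apply: ler_sum => c /C_edge[u cu]; rewrite mulrC ler_wpM2l //.
  by rewrite wdeg_neighbors setTI; exact: half_neighbors cu.
have := @weighted_sum_le_threshold _ _ predT y (wdeg e y C) (mass C) (mass C / 6).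
rewrite y1 => threshold; have {}threshold := threshold
  (fun v _ => y0 v) (fun v _ => wdeg_le_sum e v (in1W y0)) (divr_ge0 (ltW C0) (ler0n _ _)).
have {total threshold} : 1 / 4 * mass C <= mass W * mass C.
  rewrite [mass W](eq_bigl (fun w => mass C / 6 <= wdeg e y C w)) => [|w].
    have := ler_wpM2r (ltW C0) delta_le; lra.
  by rewrite inE.
rewrite ler_pM2r // => W_heavy; apply: le_trans W_heavy _.
by rewrite mulrC; apply: sum_le_card_mul => w _.
Qed.

Let weight_bound_gt0 (C : {set V}) (eta : R) :
  (forall v, y v <= eta) -> 0 < mass C -> 0 < eta.
Proof.
move=> yeta; rewrite !ltNge; apply: contraNN => eta0.
by apply: sumr_le0 => v _; exact: le_trans (yeta v) eta0.
Qed.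

Lemma card_heavy_codegrees (C : {set V}) (eta : R) (n t : nat) :
  {in C, forall c, exists u, e c u} -> (forall v, y v <= eta) -> 0 < mass C ->
  (12 * n * t.+1)%:R * eta <= delta ->
  (2 * n <= #|[set w | (mass C / 6 <= wdeg e y C w)%R]|)%N.
Proof.
move=> C_edge yeta C0 small; have eta0 := weight_bound_gt0 yeta C0.
have := many_heavy_codegrees C_edge yeta C0; set W := [set w | _] => W4.
rewrite leqNgt; apply/negP => /ltnW W_small.
have n_le : (n <= n * t.+1)%N by exact: leq_pmulr.
rewrite -(ler_nat R) natrM in W_small; rewrite -(ler_nat R) in n_le.
have := ler_wpM2l (ltW eta0) W_small; have := ler_wpM2l (ltW eta0) n_le.
move: small; rewrite -mulnA natrM; set N : R := (n * t.+1)%:R.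
by move: delta_le delta0 W4; lra.
Qed.

(* With [#|Q| = 12 k] vertices of codegree at least 1/6 of [mass C], the average
   number of neighbours in [Q] is [2 k], twice the [k - 1] that are needed. *)
Let KST_condition (C : {set V}) (eta : R) (k t : nat) :
  (0 < k)%N -> 0 < eta -> delta <= mass C ->
  (12 * 2 ^ (12 * k) * t.+1)%:R * eta <= delta ->
  (2 ^ (12 * k) * t)%:R * eta * (12 * k)%:R <
    ((12 * k)%:R * 6^-1 - (k.-1)%:R) * mass C.
Proof.
move=> k0 eta0 C_heavy small; apply: (@lt_le_trans _ _ (k%:R * delta)); last first.
  have -> : (k.-1)%:R = k%:R - 1 :> R by rewrite -subn1 natrB.
  by rewrite natrM; have := ler_wpM2l (ler0n R k) C_heavy; move: delta0; lra.
have -> : (2 ^ (12 * k) * t)%:R * eta * (12 * k)%:R =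
    k%:R * ((12 * 2 ^ (12 * k) * t)%:R * eta) by rewrite !natrM; ring.
rewrite ltr_pM2l ?ltr0n //; apply: lt_le_trans _ small.
by rewrite ltr_pM2r // ltr_nat ltn_pmul2l // muln_gt0 expn_gt0.
Qed.

Lemma codegree_lt (k t : nat) (eta : R) u v :
  (0 < k)%N -> F_free (@Kplus_rel k t) e -> (forall w, y w <= eta) ->
  (12 * 2 ^ (12 * k) * t.+1)%:R * eta <= delta -> e u v ->
  mass (neighbors e u :&: neighbors e v) < delta.
Proof.
move=> k0 Ff yeta small uv; have [es _] := ge.
rewrite ltNge; apply/negP; set C := _ :&: _ => C_heavy.
have C0 : 0 < mass C := lt_le_trans delta0 C_heavy.
have C_edge : {in C, forall c, exists w, e c w}.
  by move=> c; rewrite !inE => /andP[uc _]; exists u; rewrite es.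
have eta0 := weight_bound_gt0 yeta C0.
set W := [set w | mass C / 6 <= wdeg e y C w].
have W_large : (2 * 2 ^ (12 * k) <= #|W|)%N.
  exact: card_heavy_codegrees C_edge yeta C0 small.
have [Q QW cQ] : exists2 Q : {set V}, Q \subset W :\: [set u; v] & #|Q| = (12 * k)%N.
  apply: subset_of_card; rewrite cardsD; have := ltn_expl (12 * k) (isT : 1 < 2)%N.
  have := subset_leq_card (subsetIr W [set u; v]); rewrite cards2.
  by case: (u != v) => /=; move: W_large; lia.
have notin_Q w : w \in [set u; v] -> w \notin Q.
  by move=> wuv; apply/negP => /(subsetP QW); rewrite in_setD wuv.
have Q_deg : {in Q, forall q, 6^-1 * mass C <= wdeg e y C q}.
  by move=> q /(subsetP QW); rewrite in_setD mulrC => /andP[_]; rewrite inE.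
have [|K [D [KQ DC kK tD KD]]] :=
  weighted_KST (s := k.-1) (t := t) es y0 Q_deg (in1W yeta) (ltW eta0).
  by rewrite cQ; exact: KST_condition.
apply: Ff; apply: (Kplus_subgraph ge k0 kK tD _ _ uv).
- by apply: contra (notin_Q u _); [exact: (subsetP KQ) | rewrite !inE eqxx].
- by apply: contra (notin_Q v _); [exact: (subsetP KQ) | rewrite !inE eqxx orbT].
- move=> w c; rewrite !inE => /or3P[/eqP->|/eqP->|wK] cD; last exact: KD.
  all: by have := subsetP DC _ cD; rewrite !inE => /andP[].
Qed.

End LightVertices.

Section NearlyDisjointNeighborhoods.
Variables (R : realFieldType) (V : finType) (e : rel V) (y : V -> R) (delta : R).
Hypotheses (ge : simple_graph e) (y0 : forall v, 0 <= y v) (y1 : \sum_v y v = 1).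
Hypothesis delta_le : 26 * delta <= 1.
Let N := neighbors e.
Let mass (S : {set V}) := \sum_(v in S) y v.
Hypothesis half_neighbors : forall u v, e u v -> 1 / 2 - delta <= mass (N u).
Hypothesis small_codegree : forall u v, e u v -> mass (N u :&: N v) < delta.

Let mass_overlap (A B S : {set V}) : A \subset S -> B \subset S ->
  mass A + mass B - mass S <= mass (A :&: B).
Proof.
move=> AS BS; have : mass (A :\: B) <= mass (S :\: B).
  by apply: ler_sum_subset => // v; apply/subsetP/setSD.
rewrite /mass [\sum_(v in A) _](big_setID B) [\sum_(v in S) _](big_setID B) /=.
by rewrite (setIidPr BS); lra.
Qed.

Let mass_setC (A : {set V}) : mass (~: A) = 1 - mass A.
Proof. by rewrite -y1 (sumr_setC A) addrAC subrr add0r. Qed.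

Let mass_subset (A B : {set V}) : A \subset B -> mass A <= mass B.
Proof. by move=> /subsetP AB; exact: ler_sum_subset. Qed.

Let mass_neighbors_le u v : e u v -> mass (N u) <= 1 / 2 + 2 * delta.
Proof.
move=> uv; have [es _] := ge; have vu : e v u by rewrite es.
have := mass_overlap (subsetT (N u)) (subsetT (N v)).
have -> : mass [set: V] = 1 by rewrite -y1; apply: eq_bigl => v'; rewrite inE.
by have := half_neighbors vu; have := small_codegree uv; lra.
Qed.

(* Up to negligible weight both neighbourhoods lie in the complement of [N c],
   which has weight about 1/2. *)
Lemma common_neighbor_overlap u z c : e u c -> e z c ->
  1 / 2 - 5 * delta <= mass (N z :&: N u).
Proof.
move=> uc zc; have [es _] := ge; have cu : e c u by rewrite es.
have outside w : e w c -> 1 / 2 - 2 * delta <= mass (N w :\: N c).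
  move=> wc; have := half_neighbors wc; have := small_codegree wc.
  by rewrite /mass [\sum_(v in N w) _](big_setID (N c)) /=; lra.
have := mass_overlap (subsetDr (N z) (N c)) (subsetDr (N u) (N c)).
have : mass ((N z :\: N c) :&: (N u :\: N c)) <= mass (N z :&: N u).
  by apply: mass_subset; apply: setISS; exact: subsetDl.
have := mass_setC (N c); have := half_neighbors cu.
by have := outside _ uc; have := outside _ zc; lra.
Qed.

(* One side of the bipartition consists of the vertices sharing a neighbour
   with a fixed non-isolated vertex [u]. *)
Lemma bipartite_of_small_codegree :
  exists P : {set V}, forall a b, e a b -> (a \in P) != (b \in P).
Proof.
have [es _] := ge.
have [/existsP[u /existsP[v uv]]|no_edge] := boolP [exists u, exists v, e u v];
  last first.
  exists set0 => a b ab; case/negP: no_edge.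
  by apply/existsP; exists a; apply/existsP; exists b.
exists [set z | [exists c, e u c && e z c]] => a b ab; have ba : e b a by rewrite es.
have codeg_ab := small_codegree ab; rewrite !inE; apply/negP => /eqP same_side.
have degu := mass_neighbors_le uv.
have [near_a|far_a] := boolP [exists c, e u c && e a c].
  have near_b : [exists c, e u c && e b c] by rewrite -same_side.
  case/existsP: near_a => c /andP[uc ac]; case/existsP: near_b => d /andP[ud bd].
  have := mass_overlap (subsetIr (N a) (N u)) (subsetIr (N b) (N u)).
  have : mass ((N a :&: N u) :&: (N b :&: N u)) <= mass (N a :&: N b).
    by apply: mass_subset; apply: setISS; exact: subsetIl.
  have := common_neighbor_overlap uc ac; have := common_neighbor_overlap ud bd.
  by move: delta_le; lra.
have avoid_u w : ~~ [exists c, e u c && e w c] -> N w \subset ~: N u.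
  move=> far; apply/subsetP => c; rewrite !inE => wc; apply: contra far => uc.
  by apply/existsP; exists c; rewrite uc.
have far_b : ~~ [exists c, e u c && e b c] by rewrite -same_side.
have := mass_overlap (avoid_u a far_a) (avoid_u b far_b); rewrite mass_setC.
have := half_neighbors ab; have := half_neighbors ba; have := half_neighbors uv.
by move: delta_le; lra.
Qed.

End NearlyDisjointNeighborhoods.

(** * Cleaning *)

Section VertexDeletion.
Variables (R : realType) (V : finType) (e : rel V).
Hypothesis ge : simple_graph e.
Implicit Types (S : {set V}) (x : V -> R).

Lemma adj_form_le_spec_rad_induced x S :
  adj_form e x S S <= spec_rad R (induced e S) * \sum_(v in S) x v ^+ 2.
Proof.
pose y v := if v \in S then x v else 0.
have yx : {in S, y =1 x} by move=> v vS; rewrite /y vS.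
have [es _] := induced_simple S ge; have := adj_form_le_spec_rad es y.
rewrite adj_form_induced (sumr_setC S) [X in _ + X]big1 ?addr0 => [|v]; last first.
  by rewrite inE /y => /negbTE ->; rewrite expr0n.
have -> : \sum_(v in S) y v ^+ 2 = \sum_(v in S) x v ^+ 2.
  by apply: eq_bigr => v /yx ->.
congr (_ <= _); apply: eq_bigr => v vS; rewrite yx //; congr (_ * _).
exact: eq_wdeg.
Qed.

Lemma edges_delete v :
  (#|edges (induced e [set~ v])| + deg e [set: V] v = #|edges e|)%N.
Proof.
have [es ei] := ge; have ge' := induced_simple [set~ v] ge.
have loop : deg e [set v] v = 0%N.
  by apply: eq_card0 => w; rewrite !inE; case: eqP => // ->; rewrite ei.
apply/eqP; rewrite -(eqn_pmul2l (isT : 0 < 2)%N) mulnDr -!handshake // arcs_induced.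
rewrite (arcs_split [set v] es) (deg_setC _ [set v]) /arcs !big_set1 loop.
by apply/eqP; lia.
Qed.

Lemma perron_delete l x v : perron e l x ->
  0 <= l * (1 - 2 * x v ^+ 2) <= spec_rad R (induced e [set~ v]) * (1 - x v ^+ 2).
Proof.
move=> px; have [es ei] := ge.
have loop : wdeg e x [set v] v = 0.
  by apply: big1 => w; rewrite inE => /andP[/eqP ->]; rewrite ei.
have formE : adj_form e x [set~ v] [set~ v] = l * (1 - 2 * x v ^+ 2).
  have := adj_form_split x [set v] es.
  rewrite (perron_adj_form px) /adj_form !big_set1 loop.
  have := perron_eigen px v; rewrite (wdeg_setC _ _ [set v]) loop add0r => <-; lra.
rewrite -formE adj_form_ge0 //=; last exact: perron_ge0 px.
have -> : 1 - x v ^+ 2 = \sum_(w in [set~ v]) x w ^+ 2.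
  by rewrite -(perron_sum_setC px [set v]) big_set1 addrAC subrr add0r.
exact: adj_form_le_spec_rad_induced.
Qed.

End VertexDeletion.

Section Cleaning.
Variables (R : realType) (c : R).

Definition energy (V : finType) (e : rel V) : R :=
  spec_rad R e ^+ 2 - c * #|edges e|%:R.

(* No degree exceeds by much what the Perron weight of the vertex pays for. *)
Definition clean (V : finType) (e : rel V) : Prop :=
  forall x v, perron e (spec_rad R e) x ->
  c * (deg e [set: V] v)%:R * (1 - x v ^+ 2) <= 2 * spec_rad R e ^+ 2 * x v ^+ 2.

Lemma sqr_gap_le (a b y : R) : 0 <= a * (1 - 2 * y) <= b * (1 - y) -> 0 <= y <= 1 ->
  (a ^+ 2 - b ^+ 2) * (1 - y) <= 2 * a ^+ 2 * y.
Proof.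
move=> /andP[ay0 ab] /andP[y0 y1]; have [->|yn1] := eqVneq y 1.
  by rewrite subrr mulr0 mulr1 mulr_ge0 ?sqr_ge0.
have y1' : 0 < 1 - y by rewrite subr_gt0 lt_def y1 eq_sym yn1.
rewrite -(ler_pM2r y1').
have : (a * (1 - 2 * y)) ^+ 2 <= (b * (1 - y)) ^+ 2.
  by rewrite ler_pXn2r ?nnegrE // (le_trans ay0).
by have := sqr_ge0 (a * y); lra.
Qed.

Lemma clean_of_energy_max (V : finType) (e : rel V) : simple_graph e ->
  (forall v, energy (induced e [set~ v]) <= energy e) -> clean e.
Proof.
move=> ge emax x v px; apply: le_trans (sqr_gap_le (perron_delete ge v px) _); last first.
  by rewrite sqr_ge0 (perron_sqr_le1 px).
apply: ler_wpM2r; first by rewrite subr_ge0 (perron_sqr_le1 px).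
have := emax v; rewrite /energy -(edges_delete ge v) natrD.
by move: (spec_rad R e) (spec_rad R (induced e _)) => l l'; lra.
Qed.

Lemma exists_clean_subgraph (V : finType) (e : rel V) : simple_graph e ->
  exists S : {set V}, energy e <= energy (induced e S) /\ clean (induced e S).
Proof.
move=> ge; have [S _ Smax] :=
  @Order.TotalTheory.arg_maxP _ _ _ [set: V] predT (fun S => energy (induced e S)) isT.
exists S; split; first by have := Smax [set: V] isT; rewrite inducedT.
apply: clean_of_energy_max => [|v]; first exact: induced_simple.
have -> : induced (induced e S) [set~ v] = induced e (S :\ v).
  apply/funext => a; apply/funext => b; rewrite /induced !inE -!andbA.
  by case: (a != v); case: (b != v); rewrite ?andbF.
exact: Smax.
Qed.

End Cleaning.

Lemma clean_heavy_vertex (R : realType) (k t : nat) (delta eta : R) (V : finType)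
    (e : rel V) (x : V -> R) :
  simple_graph e -> (0 < k)%N -> F_free (@Kplus_rel k t) e ->
  0 < delta -> 26 * delta <= 1 -> 0 <= eta ->
  (12 * 2 ^ (12 * k) * t.+1)%:R * eta <= delta ->
  clean (1 - delta) e -> perron e (spec_rad R e) x ->
  #|edges e|%:R < spec_rad R e ^+ 2 -> exists v, eta < x v ^+ 2.
Proof.
move=> ge k0 Ff delta0 delta_le eta0 small cl px many.
have [/existsP//|] := boolP [exists v, eta < x v ^+ 2].
rewrite negb_exists => /forallP light; exfalso.
have {}light v : x v ^+ 2 <= eta by rewrite leNgt.
have y0 v : 0 <= x v ^+ 2 by exact: sqr_ge0.
have [_ y1 _] := px.
have light_delta v : x v ^+ 2 <= delta.
  apply: le_trans (light v) (le_trans _ small); rewrite ler_peMl // ler1n.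
  by rewrite !muln_gt0 expn_gt0.
have half u v : e u v -> 1 / 2 - delta <= \sum_(c in neighbors e u) x c ^+ 2.
  move=> uv; have := cl x u px; have := perron_sqr_le px u.
  rewrite wdeg_neighbors setTI; set Y := \sum_(c in _) _; set d := (deg e _ u)%:R.
  move=> dY clean_u; have d0 : 0 < d by rewrite ltr0n (deg_gt0 _ uv).
  have : d * ((1 - delta) * (1 - delta)) <= d * (2 * Y).
    have : 0 <= d * ((1 - delta) * (delta - x u ^+ 2)).
      by rewrite !mulr_ge0 ?subr_ge0 //; lra.
    lra.
  by rewrite ler_pM2l //; have := sqr_ge0 delta; lra.
have codegree u v : e u v ->
    \sum_(c in neighbors e u :&: neighbors e v) x c ^+ 2 < delta.
  exact: (@codegree_lt R V e (fun v => x v ^+ 2) delta ge y0 y1 delta0 delta_le half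
    k t eta u v k0 Ff light small).
have [P bipP] := bipartite_of_small_codegree ge y0 y1 delta_le half codegree.
by have := perron_sqr_le_bipartite px ge bipP; rewrite leNgt many.
Qed.

(** * Structure around a heavy vertex *)

Definition concentrated (R : realFieldType) (V : finType) (x : V -> R) (A : {set V})
    (X d : R) : Prop :=
  [/\ 0 < X, forall v, x v <= X, {in A, forall v, (1 - d) * X <= x v} &
      {in ~: A, forall v, x v <= d * X}].

Section HeavyVertex.
Variables (R : realFieldType) (V : finType) (e : rel V) (l : R) (x : V -> R).
Variables (h d : R) (u0 : V).
Let m : R := #|edges e|%:R.
Let X : R := x u0.
Hypotheses (ge : simple_graph e) (px : perron e l x) (ml : m <= l ^+ 2).
Hypotheses (xX : forall v, x v <= X) (Xh : 1 <= X ^+ 2 * h).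
Hypotheses (d0 : 0 < d) (d_le : d <= 1 / 4) (dm : h ^+ 2 <= d ^+ 10 * m).

Let L := [set v | d ^+ 2 * X <= x v].
Let A := [set v | (1 - d) * X <= x v].
Let B := [set v in ~: L | [forall u in A, e u v]].

Let x0 v : 0 <= x v. Proof. exact: perron_ge0 px v. Qed.

Let h0 : 0 < h.
Proof.
rewrite ltNge; apply/negP => /(mulr_ge0_le0 (sqr_ge0 X)).
by rewrite leNgt (lt_le_trans ltr01 Xh).
Qed.

Let h1 : 1 <= h.
Proof. by apply: le_trans Xh _; rewrite ler_piMl ?(ltW h0) ?(perron_sqr_le1 px). Qed.

Let X0 : 0 < X.
Proof.
rewrite lt_def x0 andbT; apply: contraTneq Xh => ->.
by rewrite expr0n mul0r -ltNge ltr01.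
Qed.

Let m0 : 0 < m.
Proof.
have : 0 < d ^+ 10 * m by apply: lt_le_trans dm; rewrite exprn_gt0.
by rewrite pmulr_rgt0 ?exprn_gt0.
Qed.

Lemma card_heavy_le c : 0 <= c -> #|[set v | c * X <= x v]|%:R * c ^+ 2 <= h.
Proof.
move=> c0; have sum_ge : #|[set v | c * X <= x v]|%:R * (c * X) ^+ 2 <= 1.
  apply: le_trans (perron_sum_le1 px _); apply: card_mul_le_sum => v.
  by rewrite inE => cX; rewrite ler_pXn2r ?nnegrE ?mulr_ge0 ?(ltW X0).
have card0 : 0 <= #|[set v | c * X <= x v]|%:R * c ^+ 2 by rewrite mulr_ge0 ?sqr_ge0.
have := ler_wpM2l card0 Xh; have := ler_wpM2r (ltW h0) sum_ge; lra.
Qed.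

Let card_A_le : #|A|%:R <= 4 * h.
Proof.
have d1 : 0 <= 1 - d by move: d_le; lra.
apply: le_trans (ler_wpM2l _ (card_heavy_le d1)); last by [].
have : (1 / 2) ^+ 2 <= (1 - d) ^+ 2 by rewrite ler_pXn2r ?nnegrE //; move: d_le; lra.
by move=> /(ler_wpM2l (ler0n R #|A|)); lra.
Qed.

Let card_L_sqr_le : #|L|%:R ^+ 2 <= d ^+ 2 * m.
Proof.
have := card_heavy_le (sqr_ge0 d); rewrite -/L => cL.
have {}cL : (#|L|%:R * (d ^+ 2) ^+ 2) ^+ 2 <= h ^+ 2.
  by rewrite ler_pXn2r ?nnegrE ?mulr_ge0 ?sqr_ge0 // ltW.
have d8 : 0 < d ^+ 8 by exact: exprn_gt0.
rewrite -(ler_pM2l d8) [leRHS]mulrA -exprD; apply: le_trans dm; apply: le_trans cL.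
by have -> : (#|L|%:R * (d ^+ 2) ^+ 2) ^+ 2 = d ^+ 8 * #|L|%:R ^+ 2 by ring.
Qed.

Let AL : A \subset L.
Proof.
apply/subsetP => v; rewrite !inE; apply: le_trans; rewrite ler_pM2r //.
by have := sqr_ge0 d; move: d_le d0; nra.
Qed.

Let G v := wdeg e x L v.
Let g v : R := (deg e L v)%:R.
Let N : R := (arcs e (~: L) L)%:R.

Let G_le v : G v <= g v * X.
Proof. by apply: wdeg_le_deg => w _. Qed.

Let NE : N = \sum_(v in ~: L) g v.
Proof. exact: natr_sum. Qed.

Let N_le : N <= m.
Proof. by rewrite ler_nat (arcsC _ _ (proj1 ge)) arcs_setC_le. Qed.

Lemma two_walks_le u : l ^+ 2 * x u <= wdeg e G (~: L) u + 3 * d ^+ 2 * m * X.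
Proof.
have walks : l ^+ 2 * x u <= wdeg e G [set: V] u +
    wdeg e (fun v => (deg e [set: V] v)%:R * (d ^+ 2 * X)) [set: V] u.
  have -> : l ^+ 2 * x u = wdeg e (fun v => l * x v) [set: V] u.
    by rewrite expr2 -mulrA (perron_eigen px) /wdeg mulr_sumr.
  rewrite -wdegD; apply: wdeg_le => v _; rewrite (perron_eigen px) (wdeg_setC _ _ L) lerD2l.
  apply: (@le_trans _ _ ((deg e (~: L) v)%:R * (d ^+ 2 * X))).
    by apply: wdeg_le_deg => w; rewrite !inE -ltNge => /ltW.
  rewrite ler_wpM2r ?ler_nat ?deg_subset ?subsetT //.
  by rewrite mulr_ge0 ?sqr_ge0 // ltW.
have light_walks :
    wdeg e (fun v => (deg e [set: V] v)%:R * (d ^+ 2 * X)) [set: V] u <=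
    2 * m * (d ^+ 2 * X).
  rewrite -[2]/(2%:R) -natrM -handshake // natr_sum mulr_suml; apply: wdeg_le_sum => v _.
  by rewrite !mulr_ge0 ?sqr_ge0 // ltW.
have heavy_walks : wdeg e G L u <= d ^+ 2 * m * X.
  apply: le_trans (wdeg_le_sum _ _ _) _ => [v _|]; first exact: wdeg_ge0.
  apply: (@le_trans _ _ (#|L|%:R * (#|L|%:R * X))).
    apply: sum_le_card_mul => v _; apply: le_trans (G_le v) _.
    by rewrite ler_pM2r // ler_nat deg_le_card.
  by rewrite mulrA -expr2 ler_pM2r // card_L_sqr_le.
by move: walks light_walks heavy_walks; rewrite (wdeg_setC _ G L); lra.
Qed.

Lemma missed_arcs_le u : u \in A ->
  \sum_(v in ~: L | ~~ e u v) g v <= (d + 3 * d ^+ 2) * m.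
Proof.
rewrite inE => xu; have := two_walks_le u.
have : wdeg e G (~: L) u <= wdeg e g (~: L) u * X.
  by rewrite /wdeg mulr_suml; apply: ler_sum.
have : m * ((1 - d) * X) <= l ^+ 2 * x u.
  by apply: ler_pM; rewrite ?(ltW m0) ?mulr_ge0 ?(ltW X0) // subr_ge0; move: d_le; lra.
have : N = wdeg e g (~: L) u + \sum_(v in ~: L | ~~ e u v) g v.
  by rewrite NE (bigID (e u)).
set heard := wdeg e g _ u; set missed := \sum_(v in _ | _) _ => NE' low G_heard walks.
have : X * ((1 - d - 3 * d ^+ 2) * m) <= X * heard by lra.
by rewrite ler_pM2l //; move: N_le; lra.
Qed.

Let sum_G_ge : (1 - 3 * d ^+ 2) * m * X <= \sum_(v in ~: L) G v.
Proof.
have := two_walks_le u0; have := ler_wpM2r (ltW X0) ml.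
have : wdeg e G (~: L) u0 <= \sum_(v in ~: L) G v.
  by apply: wdeg_le_sum => v _; exact: wdeg_ge0.
by rewrite -/X; lra.
Qed.

Let arcs_LA_le : (arcs e (~: L) (L :\: A))%:R <= 3 * d * m.
Proof.
rewrite -(@ler_pM2r _ (d * X)) ?mulr_gt0 //.
have : \sum_(v in ~: L) G v <= N * X - (arcs e (~: L) (L :\: A))%:R * (d * X).
  rewrite NE natr_sum !mulr_suml -sumrB; apply: ler_sum => v _.
  have -> : G v = wdeg e x A v + wdeg e x (L :\: A) v.
    by rewrite /G /wdeg (big_setIDcond _ _ A) (setIidPr AL).
  have -> : g v = (deg e A v)%:R + (deg e (L :\: A) v)%:R.
    by rewrite /g -!wdeg1 /wdeg (big_setIDcond _ _ A) (setIidPr AL).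
  have : wdeg e x A v <= (deg e A v)%:R * X by apply: wdeg_le_deg.
  have : wdeg e x (L :\: A) v <= (deg e (L :\: A) v)%:R * ((1 - d) * X).
    by apply: wdeg_le_deg => w; rewrite in_setD inE -ltNge => /andP[/ltW].
  lra.
by have := ler_wpM2r (ltW X0) N_le; have := sum_G_ge; lra.
Qed.

Let arcs_A_le :
  (arcs e (~: L) A)%:R <= #|A|%:R * #|B|%:R + #|A|%:R * ((d + 3 * d ^+ 2) * m).
Proof.
have BL : B \subset ~: L by apply/subsetP => v; rewrite inE => /andP[].
rewrite /arcs (big_setID B) (setIidPr BL) natrD natr_sum; apply: lerD.
  rewrite mulrC; apply: sum_le_card_mul => v _; rewrite ler_nat; exact: deg_le_card.
apply: (@le_trans _ _ (\sum_(u in A) \sum_(v in ~: L | ~~ e u v) g v)); last first.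
  by apply: sum_le_card_mul => u /missed_arcs_le.
rewrite [leRHS](exchange_big_dep [in ~: L]) /= => [|u v _ /andP[]//].
rewrite natr_sum; apply: (@le_trans _ _ (\sum_(v in ~: L :\: B) g v)).
  by apply: ler_sum => v _; rewrite ler_nat deg_subset.
rewrite [leRHS](big_setID B) /= -[leLHS]add0r; apply: lerD.
  by apply: sumr_ge0 => v _; apply: sumr_ge0.
apply: ler_sum => v; rewrite in_setD inE => /andP[+ vL].
rewrite vL /= => /forallPn[u]; rewrite negb_imply => /andP[uA uv].
by rewrite (bigD1 u) ?uA ?vL ?uv //= lerDl sumr_ge0.
Qed.

Let card_AB_ge : (1 - 16 * h * d) * m <= #|A|%:R * #|B|%:R.
Proof.
have NX : (1 - 3 * d ^+ 2) * m <= N.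
  rewrite -(ler_pM2r X0) NE mulr_suml; apply: le_trans sum_G_ge _.
  by apply: ler_sum.
have NAL : N = (arcs e (~: L) A)%:R + (arcs e (~: L) (L :\: A))%:R.
  rewrite -natrD; congr (_%:R); rewrite -big_split; apply: eq_bigr => v _ /=.
  by rewrite !deg_sum1 (big_setIDcond _ _ A) (setIidPr AL).
have err : 3 * d ^+ 2 + 3 * d + 4 * h * (d + 3 * d ^+ 2) <= 16 * h * d.
  have d2 : d ^+ 2 <= d / 4 by rewrite expr2; have := ler_wpM2l (ltW d0) d_le; lra.
  have := ler_wpM2l (ltW h0) d2; have := ler_wpM2r (ltW d0) h1.
  by move: d0; lra.
have e2 : #|A|%:R * (d + 3 * d ^+ 2) <= 4 * h * (d + 3 * d ^+ 2).
  by rewrite ler_wpM2r ?card_A_le // addr_ge0 ?mulr_ge0 ?(ltW d0).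
have := ler_wpM2r (ltW m0) err; have := ler_wpM2r (ltW m0) e2.
by have := arcs_A_le; have := arcs_LA_le; move: NX; rewrite NAL; lra.
Qed.

Lemma exists_concentrated_set eps : 0 < eps -> eps <= 1 -> 32 * h ^+ 2 * d <= eps ^+ 2 ->
  exists S T : {set V}, [/\ concentrated x S X eps, (0 < #|S|)%N, #|S|%:R <= 4 * h,
    complete_between e S T & (1 - eps) * m <= #|S|%:R * #|T|%:R].
Proof.
move=> eps0 eps1 deps.
have eps_sqr : eps ^+ 2 <= eps by rewrite expr2 ler_piMl // ltW.
have h2 : 1 <= h ^+ 2 by rewrite -[1](expr1n R 2) ler_pXn2r ?nnegrE ?(ltW h0).
have hd : h * d <= h ^+ 2 * d by rewrite ler_pM2r // expr2 ler_peMl ?(ltW h0).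
have d_eps : d <= eps.
  by have := ler_wpM2r (ltW d0) h2; move: d0; lra.
have AB : complete_between e A B.
  by move=> a b aA; rewrite inE => /andP[_ /forall_inP]; exact.
have BL v : v \in B -> x v < d ^+ 2 * X by rewrite !inE -ltNge => /andP[].
have dAB : [disjoint A & B].
  apply/pred0P => v /=; apply/negP => /andP[vA vB].
  by have := BL v vB; have := subsetP AL v vA; rewrite inE leNgt => /negbTE ->.
exists A, B; split=> //; last 2 first.
- by apply/card_gt0P; exists u0; rewrite inE -/X ler_piMl ?(ltW X0) // gerBl ltW.
- apply: le_trans card_AB_ge; rewrite ler_pM2r //; lra.
split=> // v.
  by rewrite inE => vA; apply: le_trans vA; rewrite ler_pM2r //; lra.
rewrite inE => vA; have [/BL/ltW vB|vB] := boolP (v \in B).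
  apply: le_trans vB _; rewrite ler_pM2r //; apply: le_trans d_eps.
  by rewrite expr2 ler_piMl ?(ltW d0) //; move: d_le; lra.
have degv : (deg e [set: V] v)%:R <= m * (32 * h * d).
  have := deg_add_arcs_le (proj1 ge) dAB AB vA vB.
  by rewrite handshake // -(ler_nat R) natrD !natrM -/m; move: card_AB_ge; lra.
have xv : x v ^+ 2 <= 32 * h * d.
  rewrite -(ler_pM2l m0); apply: le_trans degv; apply: le_trans (perron_sqr_le_deg px v).
  by rewrite ler_wpM2r ?sqr_ge0.
rewrite -(@ler_pXn2r _ 2) ?nnegrE ?mulr_ge0 ?(ltW X0) ?(ltW eps0) // exprMn.
apply: le_trans xv _; apply: le_trans (ler_wpM2r (sqr_ge0 X) deps).
have := ler_wpM2l (ltW (mulr_gt0 h0 d0)) Xh; lra.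
Qed.

End HeavyVertex.

(** * The heavy set is a clique of order k *)

Section PerronSplit.
Variables (R : realFieldType) (V : finType) (e : rel V) (l : R) (x : V -> R).
Hypotheses (ge : simple_graph e) (px : perron e l x).
Implicit Types A B : {set V}.

Lemma perron_adj_formr A : adj_form e x A [set: V] = l * \sum_(p in A) x p ^+ 2.
Proof.
rewrite mulr_sumr; apply: eq_bigr => p _.
by rewrite -(perron_eigen px) mulrCA expr2.
Qed.

Lemma perron_split A :
  l ^+ 2 * \sum_(p in A) x p ^+ 2 =
    l * adj_form e x A A + \sum_(v in ~: A) wdeg e x A v ^+ 2 +
    \sum_(v in ~: A) wdeg e x (~: A) v * wdeg e x A v.
Proof.
rewrite expr2 -mulrA -perron_adj_formr (adj_form_setCr _ _ _ A) mulrDr -addrA.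
congr (_ + _).
rewrite (adj_formC _ _ _ (proj1 ge)) mulr_sumr -big_split; apply: eq_bigr => v _ /=.
by rewrite mulrA (perron_eigen px) (wdeg_setC _ _ A); ring.
Qed.

Lemma complete_side_mass_ge A B :
  #|edges e|%:R <= l ^+ 2 -> 0 < l -> complete_between e A B ->
  7 / 8 * #|edges e|%:R <= #|A|%:R * #|B|%:R :> R ->
  1 / 4 <= \sum_(p in A) x p ^+ 2.
Proof.
set m : R := #|edges e|%:R => ml l0 AB cAB; have [es ei] := ge.
have BA : B \subset ~: A.
  by apply/subsetP => b bB; rewrite inE; apply/negP => bA; have := AB b b bA bB; rewrite ei.
have few : (arcs e (~: A) (~: A))%:R <= m / 4 :> R.
  have := arcs_subset e (subxx A) BA; rewrite (arcs_complete AB) -(ler_nat R) natrM.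
  have := congr1 (fun n => n%:R : R) (arcs_split A es).
  rewrite handshake // -/m !(natrD, natrM) -/m.
  by have := ler0n R (arcs e A A); lra.
have := adj_form_sqr_le e x (~: A) (~: A); have sum_le1 := perron_sum_le1 px.
set F := adj_form _ _ _ _ => F_sqr.
have {F_sqr}F_le : F <= l / 2.
  have F0 : 0 <= F by apply: adj_form_ge0; exact: perron_ge0 px.
  rewrite -(@ler_pXn2r _ 2) ?nnegrE ?divr_ge0 ?(ltW l0) //; apply: le_trans F_sqr _.
  apply: le_trans (_ : (arcs e (~: A) (~: A))%:R <= _); last by rewrite exprMn exprVn; lra.
  by rewrite ler_piMr // mulr_ile1 ?sum_sqr_ge0 ?sum_le1.
have := perron_adj_formr A; have := perron_adj_formr (~: A).
rewrite !(adj_form_setCr _ _ _ A) (adj_formC _ _ _ es) -/F => outer inner.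
have AA0 : 0 <= adj_form e x A A by apply: adj_form_ge0; exact: perron_ge0 px.
have yC : \sum_(v in ~: A) x v ^+ 2 = 1 - \sum_(p in A) x p ^+ 2.
  by rewrite -(perron_sum_setC px A) addrAC subrr add0r.
rewrite -(ler_pM2l l0); move: outer inner; rewrite yC.
by set cross := adj_form e x _ _; set y := \sum_(p in A) _; lra.
Qed.

End PerronSplit.

Section ComplementForm.
Variables (R : realFieldType) (V : finType) (e : rel V) (x : V -> R) (A : {set V}).
Hypotheses (ei : irreflexive e) (x0 : forall v, 0 <= x v).

Definition nonadjacent : rel V := fun u v => (u != v) && ~~ e u v.

Lemma adj_form_nonadjacent :
  adj_form e x A A + adj_form nonadjacent x A A =
  (\sum_(p in A) x p) ^+ 2 - \sum_(p in A) x p ^+ 2.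
Proof.
rewrite -big_split expr2 mulr_suml -sumrB; apply: eq_bigr => p pA /=.
rewrite -mulrDr expr2 -mulrBr; congr (_ * _).
rewrite [in RHS](bigD1 p) //= addrAC subrr add0r (bigID (e p)) /=.
congr (_ + _); apply: eq_bigl => q.
  case: (q \in A) => //=; case epq: (e p q); rewrite ?andbF ?andbT //.
  by apply/esym; apply: contraTneq epq => ->; rewrite ei.
by rewrite /nonadjacent eq_sym andbA.
Qed.

Lemma adj_form_clique : clique e A ->
  adj_form e x A A = (\sum_(p in A) x p) ^+ 2 - \sum_(p in A) x p ^+ 2.
Proof.
move=> Ac; rewrite -adj_form_nonadjacent [X in _ + X]big1 ?addr0 // => p pA.
rewrite /wdeg big1 ?mulr0 // => q /andP[qA /andP[pq]].
by rewrite Ac.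
Qed.

Lemma adj_form_le_card :
  adj_form e x A A + adj_form nonadjacent x A A <=
  (#|A|%:R - 1) * \sum_(p in A) x p ^+ 2.
Proof. by rewrite adj_form_nonadjacent mulrBl mul1r lerD2r sqr_sum_le. Qed.

Lemma adj_form_nonadjacent_ge p q : p \in A -> q \in A -> nonadjacent p q ->
  x p * x q <= adj_form nonadjacent x A A.
Proof.
move=> pA qA pq; rewrite /adj_form (bigD1 p) //= /wdeg (bigD1 q) ?qA //= mulrDr -addrA.
rewrite lerDl addr_ge0 ?mulr_ge0 ?sumr_ge0 // => v _.
by rewrite mulr_ge0 ?sumr_ge0.
Qed.

End ComplementForm.

Section ConcentratedVector.
Variables (R : realFieldType) (V : finType) (e : rel V) (l : R) (x : V -> R).
Variables (A : {set V}) (X d : R).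
Hypotheses (ge : simple_graph e) (px : perron e l x) (conc : concentrated x A X d).
Let m : R := #|edges e|%:R.
Let yA : R := \sum_(p in A) x p ^+ 2.

Lemma cross_le :
  \sum_(v in ~: A) wdeg e x (~: A) v * wdeg e x A v <=
  (arcs e (~: A) (~: A))%:R * (d * X) * (#|A|%:R * X).
Proof.
have [X0 xX _ xout] := conc; have x0 := perron_ge0 px.
rewrite natr_sum -mulrA mulr_suml; apply: ler_sum => v _; rewrite mulrA.
apply: ler_pM; [by rewrite wdeg_ge0 | by rewrite wdeg_ge0 | exact: wdeg_le_deg | ].
apply: (@le_trans _ _ ((deg e A v)%:R * X)); first exact: wdeg_le_deg.
by rewrite ler_pM2r // ler_nat deg_le_card.
Qed.

Hypothesis d_le : d <= 1 / 4.

Let close p : p \in A -> 3 / 4 * X <= x p.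
Proof.
case: conc => X0 _ xin _ /xin; apply: le_trans; rewrite ler_pM2r //.
by move: d_le; lra.
Qed.

Lemma card_concentrated_le : #|A|%:R * X ^+ 2 <= 2 * yA.
Proof.
have [X0 _ _ _] := conc; have : #|A|%:R * (3 / 4 * X) ^+ 2 <= yA.
  apply: card_mul_le_sum => p /close xp; rewrite ler_pXn2r ?nnegrE ?(perron_ge0 px) //; lra.
by have := mulr_ge0 (ler0n R #|A|) (sqr_ge0 X); lra.
Qed.

Lemma sum_sqr_concentrated_le : yA <= #|A|%:R * X ^+ 2.
Proof.
have [X0 xX _ _] := conc; apply: sum_le_card_mul => p _.
by rewrite ler_pXn2r ?nnegrE ?(perron_ge0 px) // ltW.
Qed.

Lemma spec_sqr_le_edges : l ^+ 2 * yA <= l * adj_form e x A A + m * yA.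
Proof.
have [es _] := ge; rewrite (perron_split ge px A) -addrA lerD2l.
set J : R := (arcs e (~: A) A)%:R; set F : R := (arcs e (~: A) (~: A))%:R.
have sqr_le : \sum_(v in ~: A) wdeg e x A v ^+ 2 <= J * yA.
  rewrite /J natr_sum mulr_suml; apply: ler_sum => v _.
  apply: le_trans (wdeg_sqr_le _ _ _ _) _.
  by apply: ler_wpM2l => //; apply: wdeg_le_sum => w _; exact: sqr_ge0.
have cross : \sum_(v in ~: A) wdeg e x (~: A) v * wdeg e x A v <= F * (yA / 2).
  apply: le_trans cross_le _; rewrite -mulrA ler_wpM2l //.
  have := ler_wpM2r (mulr_ge0 (ler0n R #|A|) (sqr_ge0 X)) d_le.
  by have := card_concentrated_le; lra.
have : (J + F / 2) * yA <= m * yA.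
  apply: ler_wpM2r; first exact: sum_sqr_ge0.
  have := congr1 (fun n => n%:R : R) (arcs_split A es).
  rewrite handshake // !(natrD, natrM) -/m (arcsC A _ es) -/J -/F.
  by have := ler0n R (arcs e A A); lra.
lra.
Qed.

Variables (k t : nat) (B : {set V}).
Hypotheses (k2 : (2 <= k)%N) (Ff : F_free (@Kplus_rel k t) e).
Hypotheses (A0 : (0 < #|A|)%N) (tB : (t < #|B|)%N) (AB : complete_between e A B).
Hypotheses (l0 : 0 < l) (ml : m < l ^+ 2) (lk : m - k%:R ^+ 2 <= l ^+ 2 - (k%:R - 1) * l).
Hypothesis (l_large : 2 * k%:R ^+ 3 < l).

Let k2R : 2 <= k%:R :> R. Proof. by rewrite ler_nat. Qed.

Let yA0 : 0 < yA.
Proof.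
have [X0 _ _ _] := conc; have := card_concentrated_le.
have : 0 < #|A|%:R * X ^+ 2 by rewrite mulr_gt0 ?ltr0n ?exprn_gt0.
lra.
Qed.

Let spec_sqr_le c : adj_form e x A A <= c * yA -> l ^+ 2 <= c * l + m.
Proof.
move=> formc; rewrite -(ler_pM2r yA0); apply: le_trans spec_sqr_le_edges _.
by rewrite mulrDl lerD2r (mulrC c) -mulrA ler_pM2l.
Qed.

Lemma card_heavy_set_le : (#|A| <= k)%N.
Proof.
rewrite leqNgt; apply/negP => kA; have : adj_form e x A A <= 0 * yA.
  rewrite mul0r /adj_form big1 // => p pA; rewrite /wdeg big1 ?mulr0 // => q /andP[qA pq].
  by have := Kplus_free_independent ge (ltnW k2) Ff kA tB AB pA qA; rewrite pq.
by move/spec_sqr_le; rewrite mul0r add0r leNgt ml.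
Qed.

Lemma card_heavy_set_ge : (k <= #|A|)%N.
Proof.
rewrite leqNgt; apply/negP => Ak; have A1 : #|A|%:R - 1 <= k%:R - 2 :> R.
  have : #|A|.+1%:R <= k%:R :> R by rewrite ler_nat.
  by rewrite -natr1; lra.
have : adj_form e x A A <= (k%:R - 2) * yA.
  apply: le_trans (_ : (#|A|%:R - 1) * yA <= _); last by rewrite ler_pM2r.
  apply: le_trans (adj_form_le_card _ _ (proj2 ge)); rewrite lerDl adj_form_ge0 //.
  exact: perron_ge0 px.
move/spec_sqr_le; have k23 : k%:R ^+ 2 <= 2 * k%:R ^+ 3 :> R.
  by rewrite exprS mulrA ler_peMl ?sqr_ge0 //; move: k2R; lra.
by move: lk l_large k23; lra.
Qed.

Lemma heavy_set_clique : #|A| = k -> clique e A.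
Proof.
move=> cA p q pA qA pq; apply/negPn/negP => npq; have [X0 _ _ _] := conc.
have k0 : 0 < k%:R :> R by move: k2R; lra.
have Xpq : X ^+ 2 / 2 <= adj_form (nonadjacent e) x A A.
  have nadj : nonadjacent e p q by rewrite /nonadjacent pq.
  apply: le_trans (adj_form_nonadjacent_ge (perron_ge0 px) pA qA nadj).
  have X34 : 0 <= 3 / 4 * X by lra.
  by have := ler_pM X34 X34 (close pA) (close qA); have := sqr_ge0 X; lra.
have : adj_form e x A A <= (k%:R - 1 - (2 * k%:R)^-1) * yA.
  have := adj_form_le_card x A (proj2 ge); rewrite cA -/yA => form_le.
  have : (2 * k%:R)^-1 * yA <= X ^+ 2 / 2.
    have := sum_sqr_concentrated_le; rewrite cA => yA_le.
    by rewrite invfM mulrC mulrA ler_pdivrMr //; lra.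
  lra.
move/spec_sqr_le => l_small; have : l * (2 * k%:R)^-1 <= k%:R ^+ 2 by move: lk l_small; lra.
rewrite ler_pdivrMr ?mulr_gt0 // leNgt => /negP; apply.
by have -> : k%:R ^+ 2 * (2 * k%:R) = 2 * k%:R ^+ 3 :> R by ring.
Qed.

Lemma spec_upper_bound : #|A| = k -> l ^+ 2 - (k%:R - 1) * l <= m.
Proof.
move=> cA; have : l ^+ 2 <= (k%:R - 1) * l + m; last lra.
apply: spec_sqr_le; rewrite -cA; apply: le_trans (adj_form_le_card x A (proj2 ge)).
by rewrite lerDl adj_form_ge0 //; exact: perron_ge0 px.
Qed.

End ConcentratedVector.

Section HeavyClique.
Variables (R : realFieldType) (k : nat) (V : finType) (e : rel V).

Definition nearly_extremal (l : R) : Prop :=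
  #|edges e|%:R - k%:R ^+ 2 <= l ^+ 2 - (k%:R - 1) * l.

Definition core (x : V -> R) (A : {set V}) (X : R) : Prop :=
  [/\ #|A| = k, clique e A & concentrated x A X (16 * k ^ 2)%:R^-1].

Hypothesis k2 : (2 <= k)%N.

Lemma nearly_extremal_large (l : R) : (4 * k ^ 6 + k ^ 2 < #|edges e|)%N -> 0 <= l ->
  nearly_extremal l -> 2 * k%:R ^+ 3 < l /\ #|edges e|%:R < l ^+ 2.
Proof.
rewrite /nearly_extremal -(ltr_nat R) natrD natrM !natrX.
set m := #|edges e|%:R => mk l0 lk.
have kR : 2 <= k%:R :> R by rewrite ler_nat.
have l_large : 2 * k%:R ^+ 3 < l.
  rewrite ltNge; apply/negP => l_le.
  have : l ^+ 2 <= (2 * k%:R ^+ 3) ^+ 2 by rewrite ler_pXn2r ?nnegrE // (le_trans l0).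
  have -> : (2 * k%:R ^+ 3) ^+ 2 = 4 * k%:R ^+ 6 :> R by ring.
  by have : 0 <= (k%:R - 1) * l; [rewrite mulr_ge0 //; lra | lra].
split=> //; have k23 : k%:R ^+ 2 <= 2 * k%:R ^+ 3 :> R.
  by rewrite exprS mulrA ler_peMl ?sqr_ge0 //; lra.
have : l <= (k%:R - 1) * l by rewrite ler_peMl //; lra.
lra.
Qed.

(* The first term makes [h^2 <= d^10 m] hold in [exists_concentrated_set] for
   [d^-1 = 32 h^2 (16 k^2)^2]. *)
Definition core_threshold (t h : nat) : nat :=
  maxn (h ^ 2 * (32 * h ^ 2 * (16 * k ^ 2) ^ 2) ^ 10)
    (maxn (4 * k ^ 6 + k ^ 2).+1 (8 * h * t.+1)).

Lemma heavy_vertex_concentrated (h : nat) (l : R) (x : V -> R) v :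
  simple_graph e -> perron e l x -> #|edges e|%:R <= l ^+ 2 -> 1 <= x v ^+ 2 * h%:R ->
  (h ^ 2 * (32 * h ^ 2 * (16 * k ^ 2) ^ 2) ^ 10 <= #|edges e|)%N ->
  exists A B X, [/\ concentrated x A X (16 * k ^ 2)%:R^-1, (0 < #|A|)%N, (#|A| <= 4 * h)%N,
    complete_between e A B & 15 / 16 * #|edges e|%:R <= #|A|%:R * #|B|%:R :> R].
Proof.
move=> ge px ml xv m_large; have x0 := perron_ge0 px.
have [u0 _ u0max] := @Order.TotalTheory.arg_maxP _ _ _ v predT x isT.
have xu0 : 1 <= x u0 ^+ 2 * h%:R.
  apply: le_trans xv _; rewrite ler_wpM2r // ler_pXn2r ?nnegrE //; exact: u0max.
have h0 : (0 < h)%N by case: (h) xu0 => //; rewrite mulr0 ler10.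
pose D : R := (16 * k ^ 2)%:R; pose K : R := (32 * h ^ 2 * (16 * k ^ 2) ^ 2)%:R.
have D16 : 16 <= D by rewrite ler_nat leq_pmulr // expn_gt0 ltnW.
have hR : 1 <= h%:R ^+ 2 :> R by rewrite -natrX ler1n expn_gt0 h0.
have KE : K = 32 * h%:R ^+ 2 * D ^+ 2 by rewrite /K natrM (natrM _ 32) !natrX.
have D_le : D^-1 <= 1 / 16 by rewrite div1r lef_pV2 ?posrE; lra.
have K4 : 4 <= K.
  have : 1 <= h%:R ^+ 2 * D ^+ 2 by rewrite mulr_ege1 // expr_ge1 //; lra.
  by rewrite KE; lra.
have K0 : 0 < K by lra.
have hK : h%:R ^+ 2 <= K^-1 ^+ 10 * #|edges e|%:R.
  rewrite exprVn mulrC ler_pdivlMr ?exprn_gt0 // /K -natrX -natrX -natrM ler_nat.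
  exact: m_large.
have [|||||A [B [conc A0 A4 AB cAB]]] := @exists_concentrated_set R V e l x h%:R K^-1 u0
  ge px ml (fun w => u0max w isT) xu0 _ _ hK D^-1.
- by rewrite invr_gt0.
- by rewrite div1r lef_pV2 ?posrE; lra.
- by rewrite invr_gt0; lra.
- by lra.
- have hn0 : h%:R != 0 :> R by rewrite pnatr_eq0 -lt0n.
  have : 32 * h%:R ^+ 2 != 0 :> R by rewrite mulf_neq0 ?expf_neq0 // pnatr_eq0.
  by rewrite KE; set c := 32 * _ => c0; rewrite invfM mulrA divff // mul1r exprVn.
exists A, B, (x u0); split=> //; first by rewrite -(ler_nat R) natrM.
apply: le_trans cAB; rewrite ler_wpM2r //; lra.
Qed.

Lemma heavy_vertex_core (t h : nat) (l : R) (x : V -> R) v :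
  simple_graph e -> F_free (@Kplus_rel k t) e -> (core_threshold t h <= #|edges e|)%N ->
  perron e l x -> nearly_extremal l -> 1 <= x v ^+ 2 * h%:R ->
  exists A B X, [/\ core x A X, complete_between e A B,
    15 / 16 * #|edges e|%:R <= k%:R * #|B|%:R :> R &
    l ^+ 2 - (k%:R - 1) * l <= #|edges e|%:R].
Proof.
move=> ge Ff; rewrite !geq_max => /and3P[m_h m_k m_t] px lk xv.
have [l_large ml] := nearly_extremal_large m_k (perron_spec_ge0 px) lk.
have l0 : 0 < l by apply: le_lt_trans l_large; rewrite mulr_ge0 ?exprn_ge0.
have [A [B [X [conc A0 A4 AB cAB]]]] := heavy_vertex_concentrated ge px (ltW ml) xv m_h.
have tB : (t < #|B|)%N.
  rewrite ltnNge; apply/negP => Bt.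
  have : (#|A| * #|B| <= 4 * h * t)%N by exact: leq_mul.
  have : (0 < h)%N by rewrite -(@ltn_pmul2l 4) // muln0 (leq_trans A0).
  rewrite -(ltr_nat R) -!(ler_nat R) !natrM in m_t *; move: cAB m_t; rewrite -natr1.
  by have := mulr_ge0 (ler0n R h) (ler0n R t); lra.
have d_le : (16 * k ^ 2)%:R^-1 <= 1 / 4 :> R.
  rewrite ler_pdivlMr // ler_pdivrMl ?ltr0n ?muln_gt0 ?expn_gt0 ?(ltnW k2) //.
  by rewrite mulr1 ler_nat (@leq_trans 16) // leq_pmulr // expn_gt0 ltnW.
have cA : #|A| = k.
  apply/eqP; rewrite eqn_leq (card_heavy_set_le ge px conc d_le k2 Ff A0 tB AB l0 ml).
  exact: (card_heavy_set_ge ge px conc d_le k2 A0 l0 lk l_large).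
exists A, B, X; split=> //; last exact: (spec_upper_bound ge px conc d_le A0 l0 cA).
  by split=> //; exact: (heavy_set_clique ge px conc d_le k2 A0 l0 lk l_large cA).
by rewrite -cA.
Qed.

End HeavyClique.

(** * The split graph *)

Lemma bin2_mul2 k : (2 * 'C(k, 2) = k * k.-1)%N.
Proof. by rewrite -mul_bin_diag bin1. Qed.

Lemma bin2_le_sqr k : ('C(k, 2) <= k ^ 2)%N.
Proof. by have := bin2_mul2 k; rewrite expnS expn1; nia. Qed.

Section SplitGraph.
Variables k m : nat.
Let T := S_t' k m.
Let r := S_r k m.

Lemma S_rel_simple : simple_graph (@S_rel k m).
Proof.
split=> [[[a|a]|a] [[b|b]|b]|[[a|a]|a]] //=; first by rewrite eq_sym.
by rewrite eqxx.
Qed.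

Lemma S_size : ('C(k, 2) <= m)%N -> (m = 'C(k, 2) + (k * T + r))%N.
Proof. by move=> km; rewrite mulnC -divn_eq subnKC. Qed.

Lemma S_size_le : (0 < k)%N -> (k ^ 2 <= m)%N -> (m <= k * T + k ^ 2)%N.
Proof.
move=> k0; have rk : (r < k)%N by rewrite ltn_mod.
have bin_r : ('C(k, 2) + r <= k ^ 2)%N by move: (bin2_mul2 k) rk; rewrite expnS expn1; nia.
move=> km; rewrite {1}S_size; first by rewrite addnCA leq_add2l.
exact: leq_trans (bin2_le_sqr k) km.
Qed.

Variable R : realType.
Implicit Types (a : 'I_k -> R) (b c : R).

Lemma sum_S_vert (F : S_vert k m -> R) :
  \sum_v F v = \sum_i F (inl (inl i)) + \sum_j F (inl (inr j)) + F (inr tt).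
Proof.
by rewrite !big_sumType /=; congr (_ + _); rewrite (big_pred1 tt) // => -[].
Qed.

Definition S_vec a b c (v : S_vert k m) : R :=
  match v with inl (inl i) => a i | inl (inr _) => b | inr _ => c end.

Lemma sum_sqr_S_vec a b c :
  \sum_v S_vec a b c v ^+ 2 = \sum_i a i ^+ 2 + T%:R * b ^+ 2 + c ^+ 2.
Proof. by rewrite sum_S_vert /= sumr_const card_ord mulr_natl. Qed.

Lemma wdeg_S_vec a b c v : wdeg (@S_rel k m) (S_vec a b c) [set: S_vert k m] v =
  match v with
  | inl (inl i) => \sum_j a j - a i + T%:R * b + (if (i < r)%N then c else 0)
  | inl (inr _) => \sum_j a j
  | inr _ => \sum_(j < k | (j < r)%N) a j
  end.
Proof.
rewrite wdegT big_mkcond sum_S_vert; case: v => [[i|j]|[]] /=.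
- rewrite sumr_const card_ord mulr_natl; congr (_ + _ + _).
  rewrite -big_mkcond [in RHS](bigD1 i) //= addrAC subrr add0r.
  by apply: eq_bigl => j; rewrite eq_sym.
- by rewrite big1_eq !addr0.
- by rewrite -big_mkcond big1_eq !addr0.
Qed.

Lemma adj_form_S_vec a b c :
  adj_form (@S_rel k m) (S_vec a b c) [set: S_vert k m] [set: S_vert k m] =
  (\sum_i a i) ^+ 2 - \sum_i a i ^+ 2 + 2 * T%:R * b * (\sum_i a i) +
  2 * c * (\sum_(i < k | (i < r)%N) a i).
Proof.
rewrite /adj_form (eq_bigl predT) => [|v]; last by rewrite inE.
under eq_bigr do rewrite wdeg_S_vec; rewrite sum_S_vert /= sumr_const card_ord.
rewrite -[X in _ + X + _ = _]mulr_natl.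
have -> : \sum_i a i * (\sum_j a j - a i + T%:R * b + (if (i < r)%N then c else 0)) =
    (\sum_i a i) ^+ 2 - \sum_i a i ^+ 2 + T%:R * b * (\sum_i a i) +
    c * (\sum_(i < k | (i < r)%N) a i).
  have term i : a i * (\sum_j a j - a i + T%:R * b + (if (i < r)%N then c else 0)) =
      a i * \sum_j a j - a i ^+ 2 + a i * (T%:R * b) + c * (if (i < r)%N then a i else 0).
    by case: ifP => _; ring.
  under eq_bigr do rewrite term.
  rewrite !big_split /= sumrN -!mulr_suml -mulr_sumr -big_mkcond /=; ring.

rewrite -/T; ring.
Qed.

(* Given the entries [a] on the clique, the other entries of the test vector are
   chosen to satisfy the eigenvalue equation for [l]. *)
Lemma split_clique_inequality (l : R) a : 0 < l -> spec_rad R (@S_rel k m) <= l ->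
  l * ((\sum_i a i) ^+ 2 - \sum_i a i ^+ 2) + T%:R * (\sum_i a i) ^+ 2 +
    (\sum_(i < k | (i < r)%N) a i) ^+ 2 <= l ^+ 2 * \sum_i a i ^+ 2.
Proof.
set s := \sum_i a i; set rho := \sum_(i < k | _) a i; set q := \sum_i a i ^+ 2.
move=> l0 Sl; have := adj_form_le_spec_rad (proj1 S_rel_simple) (S_vec a (s / l) (rho / l)).
rewrite adj_form_S_vec sum_sqr_S_vec -/s -/rho -/q => form_le.
have norm0 : 0 <= q + T%:R * (s / l) ^+ 2 + (rho / l) ^+ 2.
  apply: addr_ge0 (sqr_ge0 _).
  exact: addr_ge0 (sum_sqr_ge0 _ _) (mulr_ge0 (ler0n _ _) (sqr_ge0 _)).
have := ler_wpM2l (ltW l0) (le_trans form_le (ler_wpM2r norm0 Sl)).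
have -> : l * (s ^+ 2 - q + 2 * T%:R * (s / l) * s + 2 * (rho / l) * rho) =
    l * (s ^+ 2 - q) + 2 * T%:R * s ^+ 2 + 2 * rho ^+ 2 by field; exact: lt0r_neq0.
have -> : l * (l * (q + T%:R * (s / l) ^+ 2 + (rho / l) ^+ 2)) =
    l ^+ 2 * q + T%:R * s ^+ 2 + rho ^+ 2 by field; exact: lt0r_neq0.
lra.
Qed.

Let sum_sqr1 : \sum_(i < k) (1 : R) ^+ 2 = k%:R.
Proof. by under eq_bigr do rewrite expr1n; rewrite sumr_const card_ord. Qed.

Lemma spec_rad_S_gt0 : (2 <= k)%N -> 0 < spec_rad R (@S_rel k m).
Proof.
move=> k2; have := adj_form_le_spec_rad (proj1 S_rel_simple) (S_vec (fun=> 1) 0 0).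
rewrite adj_form_S_vec sum_sqr_S_vec sum_sqr1 sumr_const card_ord => form_le.
have kR : 2 <= k%:R :> R by rewrite ler_nat.
have form0 : 0 < k%:R ^+ 2 - k%:R :> R by rewrite expr2; nra.
rewrite -(@pmulr_lgt0 _ k%:R) ?ltr0n 1?ltnW //; move: form_le form0.
by move: (spec_rad _ _) => l; lra.
Qed.

Lemma spec_rad_S_lower_bound (l : R) : (2 <= k)%N -> (k ^ 2 <= m)%N ->
  spec_rad R (@S_rel k m) <= l -> m%:R - k%:R ^+ 2 <= l ^+ 2 - (k%:R - 1) * l.
Proof.
move=> k2 km Sl; have l0 := lt_le_trans (spec_rad_S_gt0 k2) Sl.
have := split_clique_inequality (fun=> 1) l0 Sl.
rewrite sum_sqr1 sumr_const card_ord; set rho := \sum_(i < k | _) _ => ineq.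
have k0 : 0 < k%:R :> R by rewrite ltr0n ltnW.
have rho0 := sqr_ge0 rho.
have size_le : m%:R <= k%:R * T%:R + k%:R ^+ 2 :> R.
  by rewrite -natrM -natrX -natrD ler_nat S_size_le // ltnW.
by rewrite -(ler_pM2l k0); have := ler_wpM2l (ltW k0) size_le; lra.
Qed.

End SplitGraph.

Lemma ord_enum_prefix (V : finType) (v0 : V) (A : {set V}) (P : pred V) n : #|A| = n ->
  exists f : 'I_n -> V, [/\ injective f, forall i, f i \in A,
    {in A, forall v, exists i, f i = v} &
    forall i, P (f i) = (i < #|[set v in A | P v]|)%N].
Proof.
move=> cA; pose s := [seq v <- enum A | P v] ++ [seq v <- enum A | predC P v].
have s_perm : perm_eq s (enum A) by apply/permPl; exact: perm_filterC.
have s_uniq : uniq s by rewrite (perm_uniq s_perm) enum_uniq.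
have mem_s v : (v \in s) = (v \in A) by rewrite (perm_mem s_perm) mem_enum.
have size_s : size s = n by rewrite (perm_size s_perm) -cardE.
have size_P : size [seq v <- enum A | P v] = #|[set v in A | P v]|.
  rewrite cardE /enum_mem -filter_predI; congr size.
  by apply: eq_filter => v; rewrite /= !inE andbC.
exists (fun i => nth v0 s i); split=> [i i' /eqP|i|v vA|i].
- by rewrite nth_uniq ?size_s // => /eqP/val_inj.
- by rewrite -mem_s mem_nth ?size_s.
- have iv : (index v s < n)%N by rewrite -size_s index_mem mem_s.
  by exists (Ordinal iv); rewrite /= nth_index ?mem_s.
rewrite nth_cat size_P; case: ltnP => [lt_i|le_i].
  have : nth v0 [seq v <- enum A | P v] i \in [seq v <- enum A | P v].
    by rewrite mem_nth ?size_P.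
  by rewrite mem_filter => /andP[].
have : nth v0 [seq v <- enum A | predC P v] (i - #|[set v in A | P v]|) \in
    [seq v <- enum A | predC P v].
  by rewrite mem_nth // ltn_subLR // -size_P -size_cat size_s.
by rewrite mem_filter => /andP[/negbTE].
Qed.

(* Rayleigh's principle for the Perron vector of [e] transplanted to the split graph. *)
Lemma transplant_le (R : realType) (k m : nat) (V : finType) (e : rel V) (l : R)
    (x : V -> R) (A : {set V}) (c : R) :
  simple_graph e -> perron e l x -> 0 < l -> spec_rad R (@S_rel k m) <= l ->
  (0 < k)%N -> #|A| = k -> clique e A -> 0 <= c -> {in A, forall v, c <= x v} ->
  (S_t' k m)%:R * (\sum_(p in A) x p) ^+ 2 + ((S_r k m)%:R * c) ^+ 2 <=
  \sum_(v in ~: A) wdeg e x A v ^+ 2 +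
  \sum_(v in ~: A) wdeg e x (~: A) v * wdeg e x A v.
Proof.
move=> ge px l0 Sl k0 cA Ac c0 cx; have /card_gt0P[v0 _] : (0 < #|A|)%N by rewrite cA.
have [f [f_inj fA f_onto _]] := ord_enum_prefix v0 predT cA.
have sum_f (F : V -> R) : \sum_i F (f i) = \sum_(p in A) F p.
  have <- : [set f i | i : 'I_k] = A.
    by apply/setP => v; apply/imsetP/idP => [[i _ ->] //|/f_onto[i <-]]; exists i.
  by rewrite big_imset //; exact: in2W.
have := split_clique_inequality (fun i => x (f i)) l0 Sl.
rewrite (sum_f x) (sum_f (fun p => x p ^+ 2)) (perron_split ge px A).
rewrite (adj_form_clique x (proj2 ge) Ac); set rho := \sum_(i < k | _) _.
have : ((S_r k m)%:R * c) ^+ 2 <= rho ^+ 2.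
  have rc0 : 0 <= (S_r k m)%:R * c by rewrite mulr_ge0.
  have rho_ge : (S_r k m)%:R * c <= rho.
    apply: (@le_trans _ _ (\sum_(i < k | (i < S_r k m)%N) c)); last first.
      by apply: ler_sum => i _; exact: cx.
    rewrite -(big_ord_widen k (fun=> c)) ?sumr_const ?card_ord ?mulr_natl //.
    by rewrite ltnW ?ltn_mod.
  by rewrite ler_pXn2r ?nnegrE // (le_trans rc0).
lra.
Qed.

(** * Recognising the split graph *)

Section SplitRecognition.
Variables (k m : nat) (V : finType) (e : rel V) (A : {set V}).
Let T := S_t' k m.
Let r := S_r k m.
Hypotheses (ge : simple_graph e) (k2 : (1 < k)%N) (cA : #|A| = k) (Ac : clique e A).
Hypothesis independent : {in ~: A &, forall v w, ~~ e v w}.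

Definition full_vertices : {set V} := [set v in ~: A | deg e A v == k].
Definition partial_vertices : {set V} := [set v in ~: A | 0 < deg e A v < k]%N.

Hypothesis partial_le1 : (#|partial_vertices| <= 1)%N.
Hypothesis sum_deg : (\sum_(v in ~: A) deg e A v = k * T + r)%N.

Let k0 : (0 < k)%N. Proof. exact: ltnW. Qed.

Lemma deg_full_partial :
  (\sum_(v in ~: A) deg e A v =
   k * #|full_vertices| + \sum_(v in partial_vertices) deg e A v)%N.
Proof.
rewrite (big_setID full_vertices) (setIidPr _) /=; last first.
  by apply/subsetP => v; rewrite inE => /andP[].
congr (_ + _)%N.
  rewrite mulnC -sum_nat_const; apply: eq_bigr => v.
  by rewrite inE => /andP[_ /eqP].
rewrite (big_setID partial_vertices) /= [X in (_ + X)%N]big1 ?addn0 => [|v].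
  apply: eq_bigl => v; rewrite !inE; case: (v \in A) => //=.
  by case: eqP => //= ->; rewrite ltnn andbF.
by have := deg_le_card e A v; rewrite cA !inE; case: (v \in A) => //=; lia.
Qed.

Lemma full_partial_count :
  #|full_vertices| = T /\ (\sum_(v in partial_vertices) deg e A v = r)%N.
Proof.
set j := (\sum_(v in _) _)%N; have j_lt : (j < k)%N.
  have [P0|[z zP]] := set_0Vmem partial_vertices; first by rewrite /j P0 big_set0.
  have -> : j = deg e A z.
    rewrite /j (big_setD1 z) //= big1 ?addn0 // => v /setD1P[/eqP v_neq_z vP].
    by case: v_neq_z; exact: (card_le1_eqP partial_le1).
  by move: zP; rewrite inE => /and3P[].
have := edivn_eq #|full_vertices| j_lt.
by rewrite mulnC -deg_full_partial sum_deg mulnC edivn_eq ?ltn_mod // => -[].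
Qed.

Lemma exists_apex : exists z, {in partial_vertices, forall v, v = z} /\
  ((0 < r)%N -> z \in partial_vertices /\ deg e A z = r).
Proof.
have [_ rE] := full_partial_count.
have [P0|[z zP]] := set_0Vmem partial_vertices.
  have /card_gt0P[z _] : (0 < #|A|)%N by rewrite cA.
  by exists z; split=> [v|]; [rewrite P0 inE | rewrite -rE P0 big_set0].
have z_only v : v \in partial_vertices -> v = z.
  by move=> vP; exact: (card_le1_eqP partial_le1).
exists z; split=> // _; split=> //; rewrite -rE (big_setD1 z) //= big1 ?addn0 // => v.
by case/setD1P => /eqP v_neq_z /z_only.
Qed.

Section Embedding.
Variables (f : 'I_k -> V) (g : 'I_T -> V) (z : V).
Hypotheses (f_inj : injective f) (fA : forall i, f i \in A).
Hypothesis f_onto : {in A, forall v, exists i, f i = v}.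
Hypothesis ef : forall i, e z (f i) = (i < deg e A z)%N.
Hypotheses (g_inj : injective g) (gF : forall j, g j \in full_vertices).
Hypothesis g_onto : {in full_vertices, forall v, exists j, g j = v}.
Hypothesis z_only : {in partial_vertices, forall v, v = z}.
Hypothesis zr : (0 < r)%N -> z \in partial_vertices /\ deg e A z = r.

Definition split_map (v : S_vert k m) : V :=
  match v with inl (inl i) => f i | inl (inr j) => g j | inr _ => z end.

Let gA j : g j \in ~: A. Proof. by have := gF j; rewrite inE => /andP[]. Qed.

Let e_gf j i : e (g j) (f i).
Proof.
have := gF j; rewrite inE => /andP[_ /eqP cd].
have /setP/(_ (f i)) : [set w in A | e (g j) w] = A.
  apply/eqP; rewrite eqEcard -[#|[set _ in _ | _]|]/(deg e A (g j)) cd cA leqnn andbT.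
  by apply/subsetP => w; rewrite inE => /andP[].
by rewrite inE fA.
Qed.

Lemma nonisol_apex : (inr tt : S_vert k m) \in nonisol (@S_rel k m) -> (0 < r)%N.
Proof. by rewrite inE => /existsP[[[i|j]|?]] //=; apply: leq_trans. Qed.

Lemma split_map_hom :
  {in nonisol (@S_rel k m) &, forall u v, e (split_map u) (split_map v) = S_rel u v}.
Proof.
have [es ei] := ge; have z_out : (inr tt : S_vert k m) \in nonisol (@S_rel k m) ->
    z \in ~: A /\ deg e A z = r.
  by move/nonisol_apex/zr => [+ ->]; rewrite inE => /andP[].
move=> [[i|j]|[]] [[i'|j']|[]] uN vN /=.
- have [->|ii'] := eqVneq i i'; first by rewrite ei.
  by rewrite Ac // (inj_eq f_inj).
- by rewrite es e_gf.
- by rewrite es ef; have [_ ->] := z_out vN.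
- exact: e_gf.
- exact/negbTE/independent.
- by apply/negbTE/independent => //; have [] := z_out vN.
- by rewrite ef; have [_ ->] := z_out uN.
- by apply/negbTE/independent => //; have [] := z_out uN.
- exact: ei.
Qed.

Lemma split_map_inj : {in nonisol (@S_rel k m) &, injective split_map}.
Proof.
have f_neq i v : v \in ~: A -> f i <> v by move=> + fv; rewrite -fv inE fA.
have z_out : (inr tt : S_vert k m) \in nonisol (@S_rel k m) ->
    z \in ~: A /\ z \notin full_vertices.
  move/nonisol_apex/zr => [+ _]; rewrite !inE => /andP[-> /andP[_ dk]]; split=> //.
  by rewrite negb_and ltn_eqF // orbT.
move=> [[i|j]|[]] [[i'|j']|[]] uN vN //= E.
- by rewrite (f_inj E).
- by case: (f_neq i _ (gA j')).
- by case: (f_neq i z (proj1 (z_out vN))).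
- by case: (f_neq i' _ (gA j)).
- by rewrite (g_inj E).
- by have [_] := z_out vN; rewrite -E gF.
- by case: (f_neq i' z (proj1 (z_out uN))).
- by have [_] := z_out uN; rewrite E gF.
Qed.

Lemma split_map_onto : {subset nonisol e <= split_map @: nonisol (@S_rel k m)}.
Proof.
have S_nonisol (u w : S_vert k m) : S_rel u w -> u \in nonisol (@S_rel k m).
  exact: nonisol_left.
move=> v; rewrite inE => /existsP[w vw]; apply/imsetP.
have [vA|vA] := boolP (v \in A).
  have [i <-] := f_onto vA; have i'k : ((i == 0 :> nat) < k)%N by case: (_ == _).
  exists (inl (inl i)) => //; apply: (S_nonisol _ (inl (inl (Ordinal i'k)))).
  by rewrite /= -(inj_eq val_inj) /=; case: (i : nat).
have wA : w \in A by apply: contraLR vw => wA; apply: independent; rewrite inE.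
have dv : (0 < deg e A v)%N := deg_gt0 wA vw.
have [vF|vF] := boolP (v \in full_vertices).
  have [j <-] := g_onto vF; exists (inl (inr j)) => //.
  exact: (S_nonisol _ (inl (inl (Ordinal k0)))).
have vP : v \in partial_vertices.
  by move: vF (deg_le_card e A v); rewrite !inE vA dv cA /=; lia.
have r0 : (0 < r)%N.
  have [_ <-] := full_partial_count; rewrite (big_setD1 v) //=.
  exact: leq_trans dv (leq_addr _ _).
exists (inr tt); last exact: z_only.
exact: (S_nonisol _ (inl (inl (Ordinal k0)))).
Qed.

End Embedding.

Lemma same_graph_S : same_graph e (@S_rel k m).
Proof.
have [z [z_only zr]] := exists_apex.
have [f [f_inj fA f_onto ef]] := ord_enum_prefix z (e z) cA.
have [g [g_inj gF g_onto _]] := ord_enum_prefix z predT (proj1 full_partial_count).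
apply: (same_graph_sym (inr tt)).
apply: (@same_graph_of_embedding _ _ _ _ (split_map f g z)).
- by case: (S_rel_simple k m).
- exact: split_map_inj.
- exact: split_map_hom.
- exact: split_map_onto.
Qed.

End SplitRecognition.

(** * The extremal structure *)

Section Profile.
Variables (R : realFieldType) (k : nat) (H : R).
Hypotheses (k2 : (1 < k)%N) (Hk : k%:R ^+ 2 - 1 <= H).

(* In units of the squared maximal entry, an upper bound for the sum of the
   squared weights sent by a clique of order [k] along [N] edges: they are packed
   greedily, [H] being the exact value for a vertex that receives all [k]. *)
Definition profile (N : nat) : R := (N %/ k)%:R * H + (N %% k)%:R ^+ 2.

Let k0 : (0 < k)%N. Proof. exact: ltnW. Qed.

Lemma profile_divmod (q i : nat) :
  (i < k)%N -> profile (q * k + i) = q%:R * H + i%:R ^+ 2.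
Proof.
by move=> ik; rewrite /profile divnMDl // divn_small // addn0 modnMDl modn_small.
Qed.

Lemma profile_small (i : nat) : (i < k)%N -> profile i = i%:R ^+ 2.
Proof. by move=> ik; rewrite /profile divn_small // modn_small // mul0r add0r. Qed.

Lemma profile_self : profile k = H.
Proof. by rewrite /profile divnn k0 modnn mul1r expr0n addr0. Qed.

(* Strict convexity of the square: two incomplete bundles are better repacked. *)
Lemma profile_superadditive (a b : nat) :
  profile a + profile b + ((0 < a %% k) && (0 < b %% k))%N%:R <= profile (a + b).
Proof.
have ak := ltn_pmod a k0; have bk := ltn_pmod b k0.
rewrite [in X in profile X](divn_eq a k) [in X in _ + profile X](divn_eq b k).
rewrite [in leRHS](divn_eq a k) [in leRHS](divn_eq b k).
move: (a %/ k)%N (b %/ k)%N ak bk => p q.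
move: (a %% k)%N (b %% k)%N => i j ik jk.
rewrite !profile_divmod // addnACA -mulnDl.
have [ijk|kij] := ltnP (i + j) k.
  rewrite profile_divmod // !natrD; have : ((0 < i) && (0 < j))%N%:R <= i%:R * j%:R :> R.
    by rewrite -natrM ler_nat -muln_gt0; case: (i * j)%N.
  by have := mulr_ge0 (ler0n R i) (ler0n R j); lra.
have -> : ((p + q) * k + (i + j) = (p + q).+1 * k + (i + j - k))%N.
  by rewrite mulSn; lia.
rewrite profile_divmod; last by lia.
rewrite natrB // -natr1 !natrD.
have : 1 <= (k%:R - i%:R) * (k%:R - j%:R) :> R.
  by rewrite -!natrB ?(ltnW ik, ltnW jk) // -natrM ler1n muln_gt0 !subn_gt0 ik.
have : ((0 < i) && (0 < j))%N%:R <= 1 :> R by case: (_ && _).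
move: Hk; lra.
Qed.

Lemma profileD_le (a b : nat) : profile a + profile b <= profile (a + b).
Proof. by apply: le_trans (profile_superadditive a b); rewrite lerDl. Qed.

Lemma le_profile (N : nat) : N%:R <= profile N.
Proof.
elim: N => [|N IHN]; first by rewrite profile_small // expr0n.
rewrite -addn1 natrD; apply: le_trans (profileD_le N 1); rewrite lerD //.
by rewrite profile_small // expr1n.
Qed.

Lemma sum_profile_le (I : Type) (s : seq I) (P : pred I) (j : I -> nat) :
  \sum_(i <- s | P i) profile (j i) <= profile (\sum_(i <- s | P i) j i).
Proof.
apply: (big_rec2 (fun a b => a <= profile b)) => [|i a b _ ab].
  by rewrite profile_small // expr0n.
by apply: le_trans (profileD_le _ _); rewrite lerD2l.
Qed.

Lemma sum_profile_lt (I : finType) (S : {set I}) (j : I -> nat) (v w : I) :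
  v \in S -> w \in S -> v != w -> (0 < j v < k)%N -> (0 < j w < k)%N ->
  \sum_(i in S) profile (j i) + 1 <= profile (\sum_(i in S) j i).
Proof.
move=> vS wS vw /andP[jv0 jvk] /andP[jw0 jwk].
have wSv : w \in S :\ v by rewrite !inE eq_sym vw.
rewrite !(big_setD1 v vS) !(big_setD1 w wSv) /= !addnA addrA.
have := profile_superadditive (j v) (j w); rewrite !modn_small // jv0 jw0 /=.
have := profileD_le (j v + j w) (\sum_(i in S :\ v :\ w) j i).
have := sum_profile_le (index_enum I) [in S :\ v :\ w] j; lra.
Qed.

End Profile.

Section ExtremalStructure.
Variables (R : realType) (k : nat) (V : finType) (e : rel V) (l : R) (x : V -> R).
Variables (A : {set V}) (X : R).
Let m := #|edges e|.
Hypotheses (ge : simple_graph e) (px : perron e l x) (l0 : 0 < l).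
Hypotheses (Sl : spec_rad R (@S_rel k m) <= l) (corex : core k e x A X).
Hypotheses (k2 : (2 <= k)%N) (km : ('C(k, 2) <= m)%N).
Let d : R := (16 * k ^ 2)%:R^-1.
Let H : R := (\sum_(p in A) x p) ^+ 2 / X ^+ 2.
Let f := #|edges (induced e (~: A))|.
Let J := (\sum_(v in ~: A) deg e A v)%N.

Let k0 : (0 < k)%N. Proof. exact: ltnW. Qed.

Let kR : 2 <= k%:R :> R. Proof. by rewrite ler_nat. Qed.

Let dk : d * k%:R ^+ 2 = 1 / 16.
Proof. by rewrite /d natrM natrX; field; rewrite pnatr_eq0 -lt0n. Qed.

Let d0 : 0 < d. Proof. by rewrite invr_gt0 ltr0n muln_gt0 expn_gt0 k0. Qed.

Let dk1 : d * k%:R <= 1 / 16.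
Proof.
rewrite -dk; apply: ler_wpM2l; first exact: ltW.
by rewrite expr2 ler_peMl //; move: kR; lra.
Qed.

Let d_le : d <= 1 / 16.
Proof.
by apply: le_trans dk1; rewrite ler_peMr ?(ltW d0) //; move: kR; lra.
Qed.

Let cA : #|A| = k. Proof. by case: corex. Qed.
Let Ac : clique e A. Proof. by case: corex. Qed.
Let conc : concentrated x A X d. Proof. by case: corex. Qed.
Let X0 : 0 < X. Proof. by case: conc. Qed.
Let xA : {in A, forall v, (1 - d) * X <= x v}. Proof. by case: conc. Qed.

Let HE : X ^+ 2 * H = (\sum_(p in A) x p) ^+ 2.
Proof. by rewrite /H mulrC divfK // expf_neq0 // gt_eqF. Qed.

Lemma clique_and_outer_edges : (J + f = k * S_t' k m + S_r k m)%N.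
Proof.
have [es ei] := ge; have := arcs_split A es.
rewrite handshake // arcs_clique // (arcsC A _ es) -arcs_induced handshake; last first.
  exact: induced_simple.
rewrite cA -bin2_mul2 -/f -[arcs e (~: A) A]/J -/m; have := S_size km.
by move: (k * _ + _)%N => s; lia.
Qed.

Let H_ge : k%:R ^+ 2 - 1 <= H.
Proof.
rewrite ler_pdivlMr ?exprn_gt0 //; have X2 := exprn_gt0 2 X0.
have kdX : 0 <= k%:R * ((1 - d) * X) by rewrite !mulr_ge0 ?(ltW X0) //; move: d_le; lra.
have := card_mul_le_sum xA; rewrite cA => sum_ge.
apply: (@le_trans _ _ ((k%:R * ((1 - d) * X)) ^+ 2)); last first.
  by rewrite ler_pXn2r ?nnegrE // (le_trans kdX).
rewrite !exprMn mulrA ler_pM2r //.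
by have := mulr_ge0 (sqr_ge0 d) (sqr_ge0 (k%:R : R)); move: dk; lra.
Qed.

Lemma received_le v : wdeg e x A v ^+ 2 <= X ^+ 2 * profile k H (deg e A v).
Proof.
have [_ xX _ _] := conc; have x0 := perron_ge0 px.
have w0 : 0 <= wdeg e x A v by rewrite wdeg_ge0.
have [full|not_full] := eqVneq (deg e A v) k.
  rewrite full profile_self // HE ler_pXn2r ?nnegrE ?sumr_ge0 //.
  exact: wdeg_le_sum.
have lt_k : (deg e A v < k)%N.
  by rewrite ltn_neqAle not_full -[X in (_ <= X)%N]cA deg_le_card.
rewrite profile_small // -exprMn mulrC.
rewrite ler_pXn2r ?nnegrE ?mulr_ge0 ?(ltW X0) //; exact: wdeg_le_deg.
Qed.

(* The comparison with the split graph: moving the [f] outer edges to the clique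
   would cost at least [f], but they pay for at most [f / 8]. *)
Lemma profile_deficit :
  profile k H (J + f) - 1 / 8 <= \sum_(v in ~: A) profile k H (deg e A v) + f%:R / 8.
Proof.
have X2 := exprn_gt0 2 X0; rewrite -(ler_pM2l X2) clique_and_outer_edges mulnC.
rewrite profile_divmod ?ltn_mod //; set T := S_t' k m; set r := S_r k m.
have dX0 : 0 <= (1 - d) * X by rewrite mulr_ge0 ?(ltW X0) //; move: d_le; lra.
have := transplant_le ge px l0 Sl k0 cA Ac dX0 xA; rewrite -HE -/T -/r => transplant.
have received : \sum_(v in ~: A) wdeg e x A v ^+ 2 <=
    X ^+ 2 * \sum_(v in ~: A) profile k H (deg e A v).
  by rewrite mulr_sumr; apply: ler_sum => v _; exact: received_le.
have cross := cross_le px conc.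
rewrite -arcs_induced handshake -/f ?cA ?natrM in cross; last exact: induced_simple.
have outer : 2 * f%:R * (d * X) * (k%:R * X) <= X ^+ 2 * (f%:R / 8).
  by have := ler_wpM2l (mulr_ge0 (ler0n R f) (sqr_ge0 X)) dk1; lra.
have leftover : X ^+ 2 * (r%:R ^+ 2 - 1 / 8) <= (r%:R * ((1 - d) * X)) ^+ 2.
  have r_le : d * r%:R ^+ 2 <= 1 / 16.
    rewrite -dk; apply: ler_wpM2l; first exact: ltW.
    by rewrite ler_pXn2r ?nnegrE // ler_nat ltnW // ltn_mod.
  have -> : (r%:R * ((1 - d) * X)) ^+ 2 = X ^+ 2 * (r%:R ^+ 2 * (1 - d) ^+ 2) by ring.
  by rewrite ler_pM2l //; have := mulr_ge0 (sqr_ge0 d) (sqr_ge0 (r%:R : R)); lra.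
lra.
Qed.

Lemma no_outer_edges : f = 0%N.
Proof.
apply/eqP; rewrite -leqn0 leqNgt; apply/negP => f1.
have f1R : 1 <= f%:R :> R by rewrite ler1n.
have := profile_deficit; have := profileD_le k2 H_ge J f; have := le_profile k2 H_ge f.
have := sum_profile_le k2 H_ge (index_enum V) [in ~: A] (deg e A); rewrite -/J; lra.
Qed.

Lemma partial_vertices_le1 : (#|partial_vertices k e A| <= 1)%N.
Proof.
apply/card_le1_eqP => v w; rewrite !inE => /andP[vA jv] /andP[wA jw].
apply/eqP/negPn/negP => vw.
have := @sum_profile_lt _ _ _ k2 H_ge _ (~: A) (deg e A) w v; rewrite !inE.
move=> /(_ wA vA vw jw jv); have := profile_deficit.
by rewrite no_outer_edges addn0 -/J; lra.
Qed.

Lemma extremal_same_graph : same_graph e (@S_rel k m).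
Proof.
apply: (same_graph_S ge k2 cA Ac).
- move=> v w vA wA; apply/negP => vw.
  have := handshake (induced_simple (~: A) ge); rewrite arcs_induced -/f no_outer_edges.
  by apply/eqP; rewrite muln0 -lt0n /arcs (big_setD1 v) //= ltn_addr // (deg_gt0 wA).
- exact: partial_vertices_le1.
- by rewrite -clique_and_outer_edges no_outer_edges addn0.
Qed.

End ExtremalStructure.

(** * The extremal graph *)

Section Extremality.
Variables (k t : nat).
Hypothesis k2 : (2 <= k)%N.

(* Vertices of weight at most the inverse of this number are light for
   [codegree_lt] with [delta = 1/30]. *)
Definition light_bound : nat := 360 * 2 ^ (12 * k) * t.+1.

Definition size_threshold : nat :=
  31 * core_threshold k t light_bound + (core_threshold k t (4 * k) + 1000 * k ^ 2).

Lemma sqr_le_size_threshold : (k ^ 2 <= size_threshold)%N.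
Proof. by rewrite /size_threshold addnA (leq_trans _ (leq_addl _ _)) // leq_pmull. Qed.

Variables (R : realType) (V : finType) (e : rel V).
Hypotheses (ge : simple_graph e) (Ff : F_free (@Kplus_rel k t) e).
Hypothesis m_large : (size_threshold <= #|edges e|)%N.
Let m : R := #|edges e|%:R.
Let l := spec_rad R e.
Hypothesis l_ge : nearly_extremal k e l.

Let kR : 2 <= k%:R :> R. Proof. by rewrite ler_nat. Qed.

Let l0 : 0 <= l. Proof. by apply: spec_rad_ge0; case: ge. Qed.

Let m_ge_core_light : (31 * core_threshold k t light_bound <= #|edges e|)%N.
Proof. exact: leq_trans (leq_addr _ _) m_large. Qed.

Let m_ge_core : (core_threshold k t (4 * k) <= #|edges e|)%N.
Proof. by apply: leq_trans m_large; rewrite /size_threshold addnCA leq_addr. Qed.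

Let m_k2 : 1000 * k%:R ^+ 2 <= m.
Proof.
rewrite -natrX -natrM ler_nat; apply: leq_trans m_large.
by rewrite /size_threshold addnA leq_addl.
Qed.

Let m_l : m < l ^+ 2.
Proof.
move: m_ge_core; rewrite !geq_max => /and3P[_ m_k _].
by have [] := nearly_extremal_large k2 m_k l0 l_ge.
Qed.

Section CleanSubgraph.
Variable S : {set V}.
Let e' := induced e S.
Let m' : R := #|edges e'|%:R.
Let l' := spec_rad R e'.
Hypothesis energy_le : energy (1 - 30^-1) e <= energy (R := R) (1 - 30^-1) e'.

Let ge' : simple_graph e'. Proof. exact: induced_simple. Qed.

Lemma clean_edges_ge (x : V -> R) : perron e' l' x -> m <= 31 * m'.
Proof.
move=> px; have := perron_sqr_le_edges px ge'; have := energy_le; have := m_l.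
by rewrite /energy -/l -/l' -/m -/m'; lra.
Qed.

Lemma clean_nearly_extremal :
  m' - k%:R ^+ 2 + (m - m') / 30 <= l' ^+ 2 - (k%:R - 1) * l'.
Proof.
have : (k%:R - 1) * l' <= (k%:R - 1) * l.
  by rewrite ler_wpM2l ?spec_rad_induced_le //; move: kR; lra.
by have := energy_le; have := l_ge; rewrite /energy /nearly_extremal -/l -/l' -/m -/m'; lra.
Qed.

End CleanSubgraph.

Lemma card_vertices_gt0 : (0 < #|V|)%N.
Proof.
have /card_gt0P[E] : (0 < #|edges e|)%N.
  by apply: leq_trans m_ge_core; rewrite !leq_max ltn0Sn orbT.
by rewrite inE => /existsP[v _]; apply/card_gt0P; exists v.
Qed.

Lemma clean_subgraph_core : exists A B : {set V},
  [/\ #|A| = k, complete_between e A B & 7 / 8 * m <= #|A|%:R * #|B|%:R].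
Proof.
have [S [energy_le cl]] := exists_clean_subgraph (1 - 30^-1 : R) ge.
set e' := induced e S in energy_le cl; have ge' : simple_graph e' by exact: induced_simple.
set l' := spec_rad R e'; pose m' : R := #|edges e'|%:R.
have [[x px] _] := spec_rad_perron R (proj1 ge') card_vertices_gt0.
have m'_ge := clean_edges_ge energy_le px.
have l'_ge := clean_nearly_extremal energy_le.
have m'_le : m' <= m by rewrite ler_nat edges_induced_le.
have m'_core : (core_threshold k t light_bound <= #|edges e'|)%N.
  rewrite -(leq_pmul2l (isT : 0 < 31)%N) (leq_trans m_ge_core_light) // -(ler_nat R) natrM.
  exact: m'_ge.
have l'_ext : nearly_extremal k e' l'.
  by move: l'_ge; rewrite /nearly_extremal -/m' -/l'; lra.
have m'_l' : m' < l' ^+ 2.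
  move: m'_core; rewrite !geq_max => /and3P[_ m_k _].
  by have [] := nearly_extremal_large k2 m_k (perron_spec_ge0 px) l'_ext.
have h0 : (0 < light_bound)%N by rewrite !muln_gt0 expn_gt0.
have hR : 0 < light_bound%:R :> R by rewrite ltr0n.
have light : (12 * 2 ^ (12 * k) * t.+1)%:R * light_bound%:R^-1 <= 30^-1 :> R.
  rewrite ler_pdivrMr // mulrC ler_pdivlMr // -natrM ler_nat /light_bound.
  by rewrite mulnC !mulnA.
have [|||v xv] :=
  clean_heavy_vertex ge' (ltnW k2) (induced_F_free Ff) _ _ _ light cl px m'_l'.
- by rewrite invr_gt0.
- by rewrite ler_pdivrMr ?mul1r ?ler_nat.
- by rewrite invr_ge0.
have {}xv : 1 <= x v ^+ 2 * light_bound%:R by rewrite -ler_pdivrMr // mul1r ltW.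
have [A [B [X [[cA _ _] AB cAB l'_le]]]] :=
  heavy_vertex_core k2 ge' (induced_F_free Ff) m'_core px l'_ext xv.
exists A, B; split=> // [a b aA bB|]; first by have /and3P[] := AB a b aA bB.
rewrite cA; apply: le_trans cAB; rewrite -/m'.
by move: l'_ge l'_le m_k2; rewrite -/l' -/m'; lra.
Qed.

Lemma nearly_extremal_same_graph :
  spec_rad R (@S_rel k #|edges e|) <= l -> same_graph e (@S_rel k #|edges e|).
Proof.
move=> Sl; have [[x px] _] := spec_rad_perron R (proj1 ge) card_vertices_gt0.
have l_gt0 : 0 < l := lt_le_trans (spec_rad_S_gt0 _ R k2) Sl.
have [A [B [cA AB cAB]]] := clean_subgraph_core.
have yA := complete_side_mass_ge ge px (ltW m_l) l_gt0 AB cAB.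
have [|v _ xv] := exists_ge_mean (fun v => x v ^+ 2) (_ : (0 < #|A|)%N).
  by rewrite cA ltnW.
have {}xv : 1 <= x v ^+ 2 * (4 * k)%:R by move: yA xv; rewrite cA natrM; lra.
have [A' [_ [X [corex _ _ _]]]] := heavy_vertex_core k2 ge Ff m_ge_core px l_ge xv.
apply: extremal_same_graph ge px l_gt0 Sl corex k2 _.
exact: leq_trans (bin2_le_sqr k) (leq_trans sqr_le_size_threshold m_large).
Qed.

End Extremality.

Theorem theorem1p11 (k t : nat) :
  (2 <= k)%N -> (k <= t)%N ->
  exists m0 : nat, forall m : nat, (m0 <= m)%N ->
  forall (R : realType) (V : finType) (e : rel V),
    simple_graph e ->
    #|edges e| = m ->
    F_free (@Kplus_rel k t) e ->
    (spec_rad R e <= spec_rad R (@S_rel k m))%R /\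
    (spec_rad R e = spec_rad R (@S_rel k m) <-> same_graph e (@S_rel k m)).
Proof.
move=> k2 _; exists (size_threshold k t) => m m_large R V e ge em Ff.
subst m; set l := spec_rad R e; set lS := spec_rad R _.
have /card_gt0P[v0 _] := card_vertices_gt0 m_large.
have same : same_graph e (@S_rel k #|edges e|) -> l = lS.
  by apply: same_graph_spec_rad v0 _ _; [case: ge | case: (S_rel_simple k #|edges e|)].
have ext : lS <= l -> same_graph e (@S_rel k #|edges e|).
  move=> Sl; apply: (nearly_extremal_same_graph k2 ge Ff m_large _ Sl).
  exact: spec_rad_S_lower_bound k2 (leq_trans (sqr_le_size_threshold k t) m_large) Sl.
split; last by split=> [E|/same //]; apply: ext; rewrite E.
by rewrite leNgt; apply/negP => /[dup] lt; rewrite (same (ext (ltW lt))) ltxx.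
Qed.
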